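(* Let $X$ be a finite set of distinct points in $\mathbb{P}^n$ over an algebraically closed field, spanning $\mathbb{P}^n$. Fix $i\in\{0,\dots,n-2\}$. Assume that: (1) there exist $n-i+1$ points of $X$ lying on a linear subspace $\mathbb{P}^{n-i-1}$ of $\mathbb{P}^n$; (2) no $n-i$ points of $X$ lie on a linear subspace $\mathbb{P}^{n-i-2}$ of $\mathbb{P}^n$; (3) $a_{n-1}(X)\neq 0$. Then there are positive integers $k$ and $r$ with $k+r=n$ such that $X$ is contained in the union $\mathbb{P}^k\cup\mathbb{P}^r$ of a $k$-dimensional and an $r$-dimensional linear subspace of $\mathbb{P}^n$.
   Context: Let $k$ be an algebraically closed field (the ground field; the letter $k$ is also used for a dimension), $\mathbb{P}^n=\mathbb{P}^n_k$, $R=k[x_0,\dots,x_n]$. $X=\{P_1,\dots,P_s\}$ is a set of $s\ge n+1$ distinct points of $\mathbb{P}^n$ not contained in any hyperplane (''spanning $\mathbb{P}^n$''), $I=I(X)\subset R$ is its defining homogeneous ideal, and $A=R/I$. For $i=1,\dots,n$, $a_i(X)=\dim_k[\mathrm{Tor}_i^R(A,k)]_{i+1}$, i.e. the multiplicity of the shift $i+1$ in the $i$-th module of the minimal graded free resolution of $A$ over $R$. *)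

(* Defs.v *)
From HB Require Import structures.
From mathcomp Require Import all_boot all_order all_algebra.
From mathcomp Require Import finmap.
From mathcomp Require Import boolp classical_sets.
From mathcomp.multinomials Require Import mpoly.

Set Implicit Arguments.
Unset Strict Implicit.
Unset Printing Implicit Defensive.

Import GRing.Theory.

Local Open Scope ring_scope.

(* A d-dimensional linear subspace of P^n is a (d+1)-dimensional vector       *)
(* subspace of K^(n+1); in particular a point is a line through the origin,   *)
(* and incidence is inclusion of vector subspaces.                            *)
Record linsub (K : fieldType) (n d : nat) := Linsub {
  linsub_vs :> {vspace 'rV[K]_n.+1};
  _ : \dim linsub_vs == d.+1
}.

HB.instance Definition _ K n d := [isSub for @linsub_vs K n d].
HB.instance Definition _ K n d := [Choice of linsub K n d by <:].

Notation pspace K n := (linsub K n 0).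

Definition on_linsub (K : fieldType) (n d : nat)
    (X : {fset pspace K n}) (L : linsub K n d) : Prop :=
  forall P : pspace K n, P \in X -> (P <= L)%VS.

Definition spanning (K : fieldType) (n : nat) (X : {fset pspace K n}) : Prop :=
  forall H : {vspace 'rV[K]_n.+1}, \dim H = n ->
    exists2 P : pspace K n, P \in X & ~~ (P <= H)%VS.

(* The homogeneous ideal I(X): all homogeneous components vanish on X.        *)
Definition vanishing_ideal (K : fieldType) (n : nat) (X : {fset pspace K n})
    (f : {mpoly K[n.+1]}) : Prop :=
  forall (d : nat) (P : pspace K n) (v : 'rV[K]_n.+1),
    P \in X -> v \in (P : {vspace _}) -> (pihomog mdeg d f).@[v 0] = 0.

Section Tor.
Variables (K : fieldType) (m : nat).
Local Notation R := {mpoly K[m]}.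

(* A matrix M with rows of degrees a and columns of degrees b, acting on row  *)
(* vectors, is a degree-0 map \bigoplus_p R(-a_p) -> \bigoplus_q R(-b_q).     *)
Definition homog_mx (r s : nat) (a : 'I_r -> nat) (b : 'I_s -> nat)
    (M : 'M[R]_(r, s)) : Prop :=
  forall p q,
    M p q = 0 \/ exists2 d : nat, a p = (b q + d)%N & M p q \is d.-homog.

(* A graded free resolution ... -> F_1 -> F_0 -> R/I -> 0 with                *)
(* F_i = \bigoplus_(p < rk i) R(-shift p).  The matrix diff i is the map      *)
(* F_(i+1) -> F_i, and the column aug lists lifts to R of the images in R/I   *)
(* of the basis of F_0.                                                       *)
Record graded_free_resolution (I : R -> Prop) := GradedFreeResolution {
  rk : nat -> nat;
  shift : forall i, 'I_(rk i) -> nat;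
  diff : forall i, 'M[R]_(rk i.+1, rk i);
  aug : 'cV[R]_(rk 0);
  diff_homog : forall i, homog_mx (@shift i.+1) (@shift i) (diff i);
  aug_homog : homog_mx (@shift 0) (fun _ : 'I_1 => 0%N) aug;
  aug_surj : forall g : R, exists u : 'rV[R]_(rk 0), I ((u *m aug) 0 0 - g);
  aug_exact : forall u : 'rV[R]_(rk 0),
    I ((u *m aug) 0 0) <-> exists v, u = v *m diff 0;
  diff_exact : forall i (u : 'rV[R]_(rk i.+1)),
    u *m diff i = 0 <-> exists v, u = v *m diff i.+1
}.

Section Homology.
Variables (I : R -> Prop) (F : graded_free_resolution I).

(* The differential of F (x)_R K, where K = R / (x_0, ..., x_(m-1)).          *)
Definition diff_tensor i : 'M[K]_(rk F i.+1, rk F i) :=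
  map_mx (mcoeff 0%MM) (diff F i).

(* Row space: the degree-j component of F_i (x) K.                            *)
Definition degree_part i (j : nat) : 'M[K]_(rk F i) :=
  diag_mx (\row_p (shift p == j)%:R).

Definition cycles i : 'M[K]_(rk F i) :=
  if i is i'.+1 then kermx (diff_tensor i') else 1%:M.

Definition homology_dim (i j : nat) : nat :=
  (\rank (degree_part i j :&: cycles i)
   - \rank (degree_part i.+1 j *m diff_tensor i))%N.

Definition minimal_resolution : Prop :=
  forall i p q, mcoeff 0%MM (diff F i p q) = 0.

(* For a minimal resolution, Tor counts the generators of F_i of degree j.    *)
Lemma homology_dim_minimal (i j : nat) : minimal_resolution ->
  homology_dim i j = #|[pred p : 'I_(rk F i) | shift p == j]|.
Proof.
move=> minF.
have dt0 i' : diff_tensor i' = 0 by apply/matrixP => p q; rewrite !mxE minF.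
rewrite /homology_dim dt0 mulmx0 mxrank0 subn0.
have cyc_full : row_full (cycles i).
  case: i => [|i'] /=; first by rewrite row_full_unit unitmx1.
  by rewrite dt0 /row_full mxrank_ker mxrank0 subn0.
have -> : \rank (degree_part i j :&: cycles i) = \rank (degree_part i j).
  apply/eqmx_rank/andP; split; first exact: capmxSl.
  by rewrite sub_capmx submx_refl submx_full.
set A := [pred p : 'I_(rk F i) | shift p == j].
pose S : 'M[K]_(#|A|, rk F i) := \matrix_(a, q) (enum_val a == q)%:R.
have SSt : S *m S^T = 1%:M.
  apply/matrixP => a b; rewrite !mxE (bigD1 (enum_val a)) //= big1 => [|q ne].
    by rewrite !mxE eqxx mul1r addr0 (inj_eq enum_val_inj) eq_sym.
  by rewrite !mxE eq_sym (negbTE ne) mul0r.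
have StS : degree_part i j = S^T *m S.
  apply/matrixP => p q; rewrite !mxE; under eq_bigr do rewrite !mxE.
  have [Ap | nAp] := boolP (p \in A); last first.
    move: (nAp); rewrite inE => /negbTE ->; rewrite mul0rn big1 // => a _.
    case: eqP => [pE | _]; last by rewrite mul0r.
    by move: nAp; rewrite -pE (enum_valP a).
  move: (Ap); rewrite inE => ->; rewrite (bigD1 (enum_rank_in Ap p)) //=.
  rewrite enum_rankK_in // eqxx mul1r big1 ?addr0 // => a ne.
  case: eqP => [pE | _]; last by rewrite mul0r.
  by case/eqP: ne; apply: enum_val_inj; rewrite enum_rankK_in.
have rS : \rank S = #|A|.
  by apply/eqP; rewrite -/(row_free S); apply/row_freeP; exists S^T.
apply/eqP; rewrite -rS eqn_leq StS mxrankM_maxr /=.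
by rewrite -{1}[S]mul1mx -SSt -mulmxA mxrankM_maxr.
Qed.

End Homology.

(* dim_K [Tor_i^R(R/I, K)]_j, which does not depend on the resolution used to *)
(* compute it.                                                                *)
Definition tor_dim (I : R -> Prop) (i j : nat) : nat :=
  xget 0%N [set t | exists F : graded_free_resolution I,
                      t = homology_dim F i j].

End Tor.

(* a_i(X) = dim_K [Tor_i^R(R/I(X), K)]_(i+1)                                  *)
Definition linear_betti (K : fieldType) (n : nat) (X : {fset pspace K n})
    (i : nat) : nat :=
  tor_dim (vanishing_ideal X) i i.+1.

(* Main.v *)
(** Write W = K^(n+1), and identify the second exterior power of W with the
    alternating matrices.  By the Koszul complex, a nonzero element of
    Tor_(n-1)(A, K)_n amounts to a linear map G from W to this exterior power
    such that v /\ G v = 0 for all v in X, that is G v = v /\ h with h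
    depending on v, and such that no single h works for all v.  The class is
    carried from the given resolution to the Koszul complex through the double
    complex built from both.

    Hypotheses (1) and (2) provide at most n+1 dependent points of X all of
    whose proper subsets are independent.  Call X separated if it lies in the
    union of two proper subspaces of W whose dimensions add up to at most
    dim W + 1.  By induction on dim W, the existence of G and of such dependent
    points forces X to be separated.  Project from a suitable point e of X.

    If G becomes trivial, then, up to a trivial map, G w = T w /\ e where T is
    diagonal on W/e in a basis of points of X, and each point x e + y of X
    satisfies (T - c) y = x u in W/e for a fixed u and some c; comparing one
    eigenspace of T with the others separates X.

    Otherwise the projection of X is separated by induction, so X lies in L u M
    with e in both and one dimension too many.  Contracting G with functionals
    that vanish on L yields maps for which the points of X on L are
    eigenvectors: either all these maps are scalar on L, or L splits as a direct
    sum compatible with X; likewise for M.  A splitting separates X, except that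
    one point q may have to be set aside.  When all maps are scalar, G is, up to
    a trivial map, glued from maps on L and on M that vanish on a common line of
    projective space, and the induction hypothesis applies to the points of X on
    L (or on M) together with three points of this line. *)

From HB Require Import structures.
Require Import Defs.
From mathcomp Require Import all_boot all_order all_algebra.
From mathcomp Require Import finmap.
From mathcomp Require Import zify ring.
From mathcomp Require Import boolp.
From mathcomp Require classical_sets.
From mathcomp.multinomials Require Import mpoly.

Set Implicit Arguments.
Unset Strict Implicit.
Unset Printing Implicit Defensive.

Import GRing.Theory.
Local Open Scope ring_scope.

(** * The exterior square as alternating matrices *)

Section Wedge.
Variables (K : fieldType) (N : nat).
Local Notation E := 'rV[K]_N.
Implicit Types (v w x e f : E) (Z : 'M[K]_N) (U V L M : {vspace E}).

Definition wedge v w : 'M[K]_N := v^T *m w - w^T *m v.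

Definition wedgel w v := wedge v w.

Lemma wedgel_is_linear w : linear (wedgel w).
Proof.
move=> a u v; rewrite /wedgel /wedge linearP /= mulmxDl -scalemxAl.
by rewrite linearP /= scalerBr opprD addrACA.
Qed.

HB.instance Definition _ w :=
  GRing.isLinear.Build K E 'M[K]_N _ (wedgel w) (wedgel_is_linear w).

Definition wedger w : 'Hom(E, 'M[K]_N) := linfun (wedgel w).

Lemma wedgerE w v : wedger w v = wedge v w.
Proof. exact: lfunE. Qed.

Lemma wedgeC v w : wedge v w = - wedge w v.
Proof. by rewrite /wedge opprB. Qed.

Lemma wedgeDl u v w : wedge (u + v) w = wedge u w + wedge v w.
Proof. exact: (linearD (wedgel w)). Qed.

Lemma wedgeZl a v w : wedge (a *: v) w = a *: wedge v w.
Proof. exact: (linearZ_LR (wedgel w)). Qed.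

Lemma wedgeDr u v w : wedge w (u + v) = wedge w u + wedge w v.
Proof. by rewrite wedgeC wedgeDl opprD -!(wedgeC w). Qed.

Lemma wedgeZr a v w : wedge w (a *: v) = a *: wedge w v.
Proof. by rewrite wedgeC wedgeZl -scalerN -wedgeC. Qed.

Lemma wedgeNr v w : wedge w (- v) = - wedge w v.
Proof. by rewrite -scaleN1r wedgeZr scaleN1r. Qed.

Lemma wedgeBr u v w : wedge w (u - v) = wedge w u - wedge w v.
Proof. by rewrite wedgeDr wedgeNr. Qed.

Lemma wedgevv v : wedge v v = 0.
Proof. exact: subrr. Qed.

Lemma wedge0l w : wedge 0 w = 0.
Proof. by rewrite -(scale0r 0) wedgeZl scale0r. Qed.

Lemma wedge0r w : wedge w 0 = 0.
Proof. by rewrite wedgeC wedge0l oppr0. Qed.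

Lemma wedge_mul v w (p : 'M[K]_N) :
  p^T *m wedge v w *m p = wedge (v *m p) (w *m p).
Proof. by rewrite /wedge mulmxBr mulmxBl !trmx_mul !mulmxA. Qed.

Lemma rV_neq0 v : v != 0 -> exists c : 'cV[K]_N, v *m c = 1%:M.
Proof.
case/rV0Pn=> i vi0; exists ((v 0 i)^-1 *: delta_mx i 0) => //.
rewrite -scalemxAr -colE; apply/matrixP=> a b.
by rewrite !ord1 !mxE mulVf.
Qed.

Lemma mulmx11 (a : 'M[K]_1) v : a *m v = a 0 0 *: v.
Proof. by rewrite {1}[a]mx11_scalar mul_scalar_mx. Qed.

(** Contracting [v^T *m w = w^T *m v] with a functional equal to 1 at [v] leaves [w] as a multiple
    of [v]. *)
Lemma wedge_eq0 v w : v != 0 -> wedge v w = 0 -> w \in <[v]>%VS.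
Proof.
case/rV_neq0=> c vc vw0; have: (c^T *m v^T) *m w = (c^T *m w^T) *m v.
  by apply/eqP; rewrite -subr_eq0 -!mulmxA -mulmxBr -/(wedge v w) vw0 mulmx0.
rewrite -trmx_mul vc trmx1 mul1mx mulmx11 => ->.
by rewrite memvZ ?memv_line.
Qed.

Lemma wedge_line v w1 w2 : v != 0 -> wedge v w1 = wedge v w2 -> w1 - w2 \in <[v]>%VS.
Proof. by move=> v0 eq_w; apply: wedge_eq0 => //; rewrite wedgeBr eq_w subrr. Qed.

(** The whole quadratic form must vanish: in characteristic 2, [Z^T = - Z] alone would not kill the
    diagonal. *)
Definition alt Z := forall v : E, v *m Z *m v^T = 0.

Lemma wedge_alt v w : alt (wedge v w).
Proof.
move=> x; rewrite /wedge mulmxBr mulmxBl.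
have E1 : x *m v^T = (v *m x^T)^T by rewrite trmx_mul trmxK.
have E2 : x *m w^T = (w *m x^T)^T by rewrite trmx_mul trmxK.
rewrite !mulmxA -!(mulmxA _ _ x^T) E1 E2 [v *m _]mx11_scalar [w *m _]mx11_scalar.
by rewrite !tr_scalar_mx -!scalar_mxM mulrC subrr.
Qed.

Lemma alt_lin a Z1 Z2 : alt Z1 -> alt Z2 -> alt (a *: Z1 + Z2).
Proof.
move=> A1 A2 x.
by rewrite mulmxDr mulmxDl A2 -scalemxAr -scalemxAl A1 scaler0 addr0.
Qed.

Lemma alt_tr Z : alt Z -> Z^T = - Z.
Proof.
move=> A; apply/matrixP=> i j; apply/eqP.
have B a b : (delta_mx 0 a : E) *m Z *m (delta_mx 0 b : E)^T = (Z a b)%:M.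
  by rewrite trmx_delta -rowE -colE; apply/matrixP=> k l; rewrite !ord1 !mxE.
have := A (delta_mx 0 i + delta_mx 0 j).
rewrite linearD /= !(mulmxDr, mulmxDl) !A add0r addr0 !B.
move=> /matrixP/(_ 0 0); rewrite !mxE /= !mulr1n => /eqP.
by rewrite addr_eq0 => /eqP->; rewrite opprK.
Qed.

Lemma span_ind (P : E -> Prop) (X : seq E) :
  P 0 -> (forall a u v, P u -> P v -> P (a *: u + v)) ->
  {in X, forall x, P x} -> {in <<X>>%VS, forall x, P x}.
Proof.
move=> P0 PD PX x /(@coord_span _ _ _ (in_tuple X)) ->.
apply: (big_ind P) => // [u v Pu Pv|i _]; first by rewrite -(scale1r u); apply: PD.
by rewrite -[_ *: _]addr0; apply: PD => //; apply/PX/mem_nth.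
Qed.

(** Serves as the quotient map modulo [L], the quotient being realised on a complement inside
    [E]. *)
Definition projm L : 'M[K]_N := lin1_mx (\1 - projv L)%VF.

Lemma mul_projm L v : v *m projm L = v - projv L v.
Proof. by rewrite /projm mul_rV_lin1 /= !lfunE /= !lfunE. Qed.

Lemma projm_eq0 L v : (v *m projm L == 0) = (v \in L).
Proof.
rewrite mul_projm subr_eq0; apply/eqP/idP=> [->|/projv_id->] //.
exact: memv_proj.
Qed.

End Wedge.

(* Elaborating {vspace 'rV_N} leaves [reverse_coercion]s that hide dimensions
   from [lia]. *)
Ltac dlia :=
  repeat match goal with
  | H : is_true (leq _ _) |- _ => revert H
  | H : @eq ?T ?a ?b |- _ => unify T nat; change (@eq nat a b) in H; revert H
  end; clear; unfold reverse_coercion; lia.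

(** * Syzygies, separated configurations and circuits *)

Section Syzygy.
Variables (K : fieldType) (N : nat).
Local Notation E := 'rV[K]_N.
Implicit Types (v w x e f : E) (Z : 'M[K]_N) (U V L M : {vspace E}).
Implicit Types (X A B s t : seq E) (G : 'Hom(E, 'M[K]_N)).

(** The witness [h] stays inside the span of [X], so that configurations spanning less than [E] can
    be treated by induction on [\dim <<X>>] in a fixed ambient space. *)
Definition syz X G :=
  {in X, forall x, exists2 h, h \in <<X>>%VS & G x = wedge x h}.

Definition trivial X G :=
  exists2 h, h \in <<X>>%VS & {in X, forall x, G x = wedge x h}.

Definition sep X := exists L M : {vspace E},
  [/\ {in X, forall x, x \in L \/ x \in M},
      (\dim L + \dim M <= (\dim <<X>>%VS).+1)%N,
      (\dim L < \dim <<X>>%VS)%N & (\dim M < \dim <<X>>%VS)%N].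

Definition indep k (b : 'I_k -> E) :=
  forall a : 'I_k -> K, \sum_i a i *: b i = 0 -> forall i, a i = 0.

(** As all coefficients are nonzero, the [b i] and their combination form a circuit in the sense of
    matroids. The bounds on [k] say that it has at least three elements and does not span. *)
Definition circuit X := exists k (b : 'I_k -> E) (c : 'I_k -> K),
  [/\ (1 < k < \dim <<X>>%VS)%N, indep b, forall i, b i \in X,
      forall i, c i != 0 & \sum_i c i *: b i \in X].

Lemma sum_memv (I : finType) (C : pred I) (b : I -> E) (y : I -> K) L :
  (forall i, C i -> b i \in L) -> (forall i, ~~ C i -> y i *: b i \in L) ->
  \sum_i y i *: b i \in L.
Proof.
move=> CL CnL; apply: memv_suml => i _.
by have [/CL bL|/CnL//] := boolP (C i); apply: memvZ.
Qed.

Lemma dim_cons_image (I : finType) (C : pred I) (b : I -> E) (e : E) :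
  (\dim <<e :: image b C>> <= #|C|.+1)%N.
Proof. by rewrite (leq_trans (dim_span _)) //= size_image. Qed.

Lemma dim_image (I : finType) (C : pred I) (b : I -> E) :
  (\dim <<image b C>> <= #|C|)%N.
Proof. by rewrite (leq_trans (dim_span _)) //= size_image. Qed.

(** Let [C] be the set of indices with eigenvalue [lam j0]. Points whose [mu] is this eigenvalue
    have their coordinates outside [C] determined by [x]; all others have coordinates on [C]
    proportional to [u]. Each kind lies in a subspace, and the two dimensions add up to at most
    [r.+2], whether or not [u] vanishes on [C]. *)
Lemma scroll_sep X r (e : E) (b : 'I_r -> E) (lam u : 'I_r -> K) (j0 : 'I_r) :
    \dim <<X>>%VS = r.+1 ->
    {in X, forall v, exists (x : K) (y : 'I_r -> K), v = x *: e + \sum_i y i *: b i /\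
       ((forall i, y i = 0) \/ exists mu, forall i, (lam i - mu) * y i = x * u i)} ->
    ~ (forall i, u i = 0 /\ lam i = lam j0) ->
    u j0 = 0 \/ (exists2 j1, j1 != j0 & lam j1 = lam j0) ->
  sep X.
Proof.
move=> dX cX ntriv hj0; pose C := [pred i | lam i == lam j0].
have cC : (#|C| + #|[predC C]| = r)%N by rewrite -[RHS](card_ord r) -(cardC C).
have C0 : j0 \in C by rewrite inE.
have bC i : C i -> b i \in image b C by move=> Ci; apply: image_f.
have bCn i : ~~ C i -> b i \in image b [predC C] by move=> Ci; apply: image_f.
have [uC|/forall_inPn[i1 Ci1 ui1]] := boolP [forall i in C, u i == 0].
  (* Here [u] vanishes on [C]: a point with a nonzero coordinate on [C] has [mu = lam j0], so
     outside [C] its coordinates are [x] times those of [t]. *)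
  pose t := \sum_i (if i \in C then 0 else u i / (lam i - lam j0)) *: b i.
  have Cpos : (0 < #|C|)%N by apply/card_gt0P; exists j0.
  have CnT : (0 < #|[predC C]|)%N.
    rewrite lt0n; apply/eqP=> Cn0; apply: ntriv => i.
    have Ci : i \in C by have := card0_eq Cn0 i; rewrite !inE => /negbFE.
    by split; apply/eqP; [exact: (forall_inP uC)|exact: Ci].
  exists <<e :: image b [predC C]>>%VS, <<(e + t)%R :: image b C>>%VS.
  have d1 : (\dim <<e :: image b [predC C]>> <= #|[predC C]|.+1)%N.
    exact: dim_cons_image.
  have d2 : (\dim <<(e + t)%R :: image b C>> <= #|C|.+1)%N by exact: dim_cons_image.
  split; rewrite ?dX; [|dlia..].
  move=> v /cX[x [y [-> yP]]].
  have [/forall_inP y0|/forall_inPn[i Ci yi]] := boolP [forall i in C, y i == 0].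
    left; apply: memvD; first by rewrite memvZ // memv_span ?mem_head.
    apply: (@sum_memv _ (predC C)) => i Ci.
      by apply/memv_span; rewrite inE bCn ?orbT.
    by rewrite (eqP (y0 i _)) ?scale0r ?mem0v // -[_ \in _]negbK.
  right; case: yP => [y0|[mu muP]]; first by rewrite y0 eqxx in yi.
  have mulam : mu = lam j0.
    have /eqP := muP i; rewrite (eqP (forall_inP uC _ Ci)) mulr0 mulf_eq0 (negbTE yi).
    by rewrite orbF subr_eq0 (eqP Ci) => /eqP->.
  have -> : x *: e + \sum_i y i *: b i =
      x *: (e + t) + \sum_i (if C i then y i else 0) *: b i.
    rewrite scalerDr -addrA; congr (_ + _); rewrite scaler_sumr -big_split /=.
    apply: eq_bigr => k _; rewrite scalerA -scalerDl; congr (_ *: _).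
    rewrite !inE; case: eqP => [_|/eqP lk]; first by rewrite mulr0 add0r.
    have := muP k; rewrite mulam addr0 mulrA => <-.
    by rewrite mulrC mulKf // subr_eq0.
  apply: memvD; first by rewrite memvZ // memv_span ?mem_head.
  apply: (@sum_memv _ C) => k Ck.
    by apply/memv_span; rewrite inE bC ?orbT.
  by rewrite ifN // scale0r mem0v.
(* Now [u] is nonzero somewhere on [C]. The second subspace has dimension at most [#|[predC C]| +
   2], so it is proper once [C] has two elements; [hj0] provides them. *)
have C2 : (1 < #|C|)%N.
  case: hj0 => [u0|[j1 j10 lam1]].
    apply/card_gt1P; exists i1, j0; split=> //.
    by apply: contraNneq ui1 => ->; apply/eqP.
  by apply/card_gt1P; exists j1, j0; split=> //; rewrite inE lam1.
pose t := \sum_(i in C) u i *: b i.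
exists <<image b C>>%VS, <<e :: t :: image b [predC C]>>%VS.
have d1 : (\dim <<image b C>> <= #|C|)%N by exact: dim_image.
have d2 : (\dim <<e :: t :: image b [predC C]>> <= #|[predC C]|.+2)%N.
  by rewrite (leq_trans (dim_span _)) //= size_image.
split; rewrite ?dX; [|dlia..].
move=> v /cX[x [y [-> [y0|[mu muP]]]]].
  right; rewrite big1 ?addr0; last by move=> i _; rewrite y0 scale0r.
  by rewrite memvZ // memv_span ?mem_head.
have [Emu|Nmu] := eqVneq mu (lam j0).
  have x0 : x = 0.
    have := muP i1; rewrite Emu (eqP Ci1) subrr mul0r => /esym/eqP.
    by rewrite mulf_eq0 (negbTE ui1) orbF => /eqP.
  left; rewrite x0 scale0r add0r; apply: (@sum_memv _ C) => k Ck; first exact/memv_span/bC.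
  have /eqP := muP k; rewrite x0 mul0r mulf_eq0 subr_eq0 Emu => /orP[Ek|/eqP->]; first by case/negP: Ck.
  by rewrite scale0r mem0v.
right; apply: memvD; first by rewrite memvZ // memv_span ?mem_head.
rewrite (bigID C) /=; apply: memvD.
  have -> : \sum_(i | C i) y i *: b i = (x / (lam j0 - mu)) *: t.
    rewrite scaler_sumr; apply: eq_bigr => k Ck; rewrite scalerA; congr (_ *: _).
    have := muP k; rewrite (eqP Ck) mulrAC => <-.
    by rewrite mulrC mulKf // subr_eq0 eq_sym.
  by rewrite memvZ // memv_span // !inE eqxx orbT.
apply: memv_suml => k Ck; rewrite memvZ // memv_span // inE; apply/orP; right.
by rewrite inE bCn ?orbT.
Qed.

Lemma free_extend X s : free s -> {subset s <= X} ->
  exists t, [/\ {subset t <= X}, free (s ++ t) & <<s ++ t>>%VS = <<X>>%VS].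
Proof.
move=> fs sX.
suff [t [tX ft Xst]] : exists t, [/\ {subset t <= X}, free (s ++ t) &
    {subset X <= <<s ++ t>>%VS}].
  exists t; split=> //; apply/eqP; rewrite eqEsubv; apply/andP; split.
    apply: sub_span => x; rewrite mem_cat => /orP[/sX|/tX] //.
  exact/span_subvP.
elim: X {sX} => [|x X [t [tX ft Xst]]]; first by exists [::]; rewrite cats0; split.
have [xt|xt] := boolP (x \in <<s ++ t>>%VS).
  exists t; split=> // y; first by move/tX; rewrite inE orbC => ->.
  by rewrite inE => /predU1P[->|/Xst].
have E1 : perm_eq (s ++ x :: t) (x :: s ++ t) by rewrite -cat1s perm_catCA.
exists (x :: t); split.
- by move=> y; rewrite !inE => /predU1P[->|/tX->]; rewrite ?eqxx ?orbT.
- by rewrite (perm_free E1) free_cons xt.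
- move=> y; rewrite (eq_span (perm_mem E1)) inE => /predU1P[->|/Xst yt].
    exact/memv_span/mem_head.
  by move: yt; apply/subvP/sub_span => z; rewrite inE orbC => ->.
Qed.

Lemma free_indep s : free s -> indep (fun i : 'I_(size s) => s`_i).
Proof. by move/(vector.freeP (X := in_tuple s)). Qed.

Lemma indep_free k (b : 'I_k -> E) : indep b -> free (mktuple b).
Proof.
move=> ib; apply/vector.freeP => a; rewrite (eq_bigr (fun i => a i *: b i)); first exact: ib.
by move=> i _; rewrite -tnth_nth tnth_mktuple.
Qed.

Lemma cons_coord (e : E) s v : v \in <<e :: s>>%VS ->
  exists (x : K) (y : 'I_(size s) -> K), v = x *: e + \sum_i y i *: s`_i.
Proof.
move=> /(@coord_span _ _ _ (in_tuple (e :: s))) ->; rewrite big_ord_recl /=.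
by do 2!eexists.
Qed.

Lemma sum_nth_mem s (y : 'I_(size s) -> K) : \sum_i y i *: s`_i \in <<s>>%VS.
Proof. by apply: memv_suml => i _; rewrite memvZ // memv_span // mem_nth. Qed.

Lemma cons_coord_inj (e : E) s : free (e :: s) ->
  forall (x : K) (y : 'I_(size s) -> K), x *: e + \sum_i y i *: s`_i = 0 ->
  x = 0 /\ forall i, y i = 0.
Proof.
rewrite free_cons => /andP[es /free_indep fs] x y.
have [->|x0] := eqVneq x 0; first by rewrite scale0r add0r => /fs.
move/eqP; rewrite addr_eq0 => /eqP xe; case/negP: es.
by rewrite -[e](scalerK x0) xe memvZ // memvN sum_nth_mem.
Qed.

Lemma syz_triv_basis X G h s : <<s>>%VS = <<X>>%VS ->
  {in s, forall x, G x = wedge x h} -> {in X, forall x, G x = wedge x h}.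
Proof.
move=> sX Gs x /memv_span; rewrite -sX.
apply: (span_ind (P := fun x => G x = wedge x h)) => //.
  by rewrite linear0 wedge0l.
by move=> a u v Gu Gv; rewrite linearP /= wedgeDl wedgeZl Gu Gv.
Qed.

(** This is the case of a trivial projection from [e]. In the basis [e :: s], up to the trivial map
    of [h0], [G] has a diagonal part [lam] and a vector [u] coming from [G e]; comparing with
    [G v = v /\ (h0 + mu *: e)] at a point [v] gives the equations of [scroll_sep]. The last
    hypothesis provides the index [j0] asked for there. *)
Lemma scroll X G (e h0 : E) s : syz X G -> ~ trivial X G ->
    e \in X -> {subset s <= X} -> free (e :: s) -> <<e :: s>>%VS = <<X>>%VS ->
    h0 \in <<X>>%VS ->
    {in X, forall x, x \in <[e]>%VS \/ exists mu, G x = wedge x (h0 + mu *: e)} ->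
    (exists (x : K) (y : 'I_(size s) -> K) (j0 j1 : 'I_(size s)),
      [/\ x *: e + \sum_i y i *: s`_i \in X, j0 != j1, y j1 != 0 &
          if x == 0 then y j0 != 0 else y j0 == 0]) ->
  sep X.
Proof.
move=> sG ntG eX sX fes spes h0X qtG [xP [yP [j0 [j1 [PX j01 yj1 hP]]]]].
have /andP[es fs] : (e \notin <<s>>%VS) && free s by rewrite -free_cons.
have e0 : e != 0 by apply: contraNneq es => ->; rewrite mem0v.
have [he heX Ge] := sG e eX.
have lamP (i : 'I_(size s)) : exists mu, G s`_i == wedge s`_i (h0 + mu *: e).
  have siX : s`_i \in X by apply/sX/mem_nth.
  have [/vlineP[a sia]|[mu ->]] := qtG _ siX; last by exists mu.
  have : s`_i != 0 by apply: (free_not0 fs); apply: mem_nth.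
  rewrite sia scaler_eq0 negb_or => /andP[a0 _]; case/negP: es.
  by rewrite -[e](scalerK a0) -sia memvZ // memv_span // mem_nth.
pose lam i := xchoose (lamP i).
have Gs (i : 'I_(size s)) : G s`_i = wedge s`_i (h0 + lam i *: e) by apply/eqP/(xchooseP (lamP i)).
have [u0 [u hu]] : exists (x : K) (y : 'I_(size s) -> K),
    he - h0 = x *: e + \sum_i y i *: s`_i by apply: cons_coord; rewrite spes memvB.
have Geu : G e = wedge e (h0 + \sum_i u i *: s`_i).
  rewrite Ge; have -> : he = h0 + (u0 *: e + \sum_i u i *: s`_i) by rewrite -hu addrC subrK.
  by rewrite !wedgeDr wedgeZr wedgevv scaler0 add0r.
have eqn (x : K) (y : 'I_(size s) -> K) : x *: e + \sum_i y i *: s`_i \in X ->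
    (forall i, y i = 0) \/ exists mu, forall i, (lam i - mu) * y i = x * u i.
  set v := _ + _ => vX; have [/vlineP[a va]|[mu Gv]] := qtG v vX.
    left; have [] // := cons_coord_inj fes (x := x - a) (y := y).
    by rewrite scalerBl addrAC -/v va subrr.
  (* The vector [z] collects the defects of the equations. It turns out to be a multiple of [e],
     hence zero, as [e :: s] is free. *)
  right; exists mu; set z := \sum_i ((lam i - mu) * y i - x * u i) *: s`_i.
  have : wedge z e = 0.
    have E1 : z = \sum_i (y i * lam i) *: s`_i - mu *: (\sum_i y i *: s`_i)
               - x *: \sum_i u i *: s`_i.
      rewrite !scaler_sumr.
      rewrite -!sumrB; apply: eq_bigr => i _.
      by rewrite !scalerA -!scalerBl; congr (_ *: _); ring.
    have E2 : wedger e (\sum_i (y i * lam i) *: s`_i) =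
       G (\sum_i y i *: s`_i) - wedge (\sum_i y i *: s`_i) h0.
      rewrite -[wedge _ h0]wedgerE !linear_sum /=.
      rewrite -big_split; apply: eq_bigr => i _.
      rewrite /= !linearZ /= Gs !wedgerE wedgeDr wedgeZr.
      by apply/matrixP=> ? ?; rewrite !mxE; ring.
    move: Gv; rewrite {1}/v linearD linearZ /= Geu => Gv.
    rewrite wedgerE in E2; rewrite E1 -!wedgerE !(linearB, linearZ) /= !wedgerE E2.
    move: Gv; rewrite /v; set S := \sum_i y i *: _; set T := \sum_i u i *: _.
    move=> Gv; have -> : G S = wedge (x *: e + S) (h0 + mu *: e) - x *: wedge e (h0 + T).
      by rewrite -Gv addrAC subrr add0r.
    rewrite !(wedgeDl, wedgeDr, wedgeZl, wedgeZr) wedgevv (wedgeC T e).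
    rewrite !scaler0 add0r !scalerDr scalerN opprK.
    by apply/matrixP=> ? ?; rewrite !mxE; ring.
  rewrite wedgeC => /eqP; rewrite oppr_eq0 => /eqP/(wedge_eq0 e0)/vlineP[a za].
  have [] // := cons_coord_inj fes (x := - a)
    (y := fun i => (lam i - mu) * y i - x * u i).
    by rewrite -/z za scaleNr addNr.
  by move=> _ y0 i; apply/eqP; rewrite -subr_eq0 y0.
apply: (@scroll_sep _ _ e (fun i => s`_i) lam u j0).
- by rewrite -spes; apply: (vector.size_basis (X := in_tuple (e :: s))); rewrite /basis_of fes eqxx.
- move=> v vX; have /cons_coord[x [y vE]] : v \in <<e :: s>>%VS by rewrite spes memv_span.
  by exists x, y; split=> //; apply: eqn; rewrite -vE.
(* Constant [lam] and zero [u] would make [G] trivial through [h0 + lam j0 *: e]. *)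
- move=> H; apply: ntG; exists (h0 + lam j0 *: e).
    by rewrite memvD // memvZ // memv_span.
  apply: (syz_triv_basis spes) => x; rewrite inE => /predU1P[->|/(nthP 0)[i si <-]].
    rewrite Geu big1 => [|i _]; last by rewrite (H i).1 scale0r.
    by rewrite addr0 wedgeDr wedgeZr wedgevv scaler0 addr0.
  by rewrite (Gs (Ordinal si)) (H (Ordinal si)).2.
(* At the given point, [x = 0] with two nonzero coordinates forces two equal eigenvalues, while
   [x != 0] with [y j0 = 0] forces [u j0 = 0]. *)
have [yP0|[mu muP]] := eqn _ _ PX; first by rewrite yP0 eqxx in yj1.
case: eqVneq hP => [x0 yj0|x0 /eqP yj0].
  right; exists j1; first by rewrite eq_sym.
  have := muP j1; have := muP j0; rewrite x0 !mul0r => /eqP.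
  rewrite mulf_eq0 (negbTE yj0) orbF subr_eq0 => /eqP-> /eqP.
  by rewrite mulf_eq0 (negbTE yj1) orbF subr_eq0 => /eqP.
left; have /esym/eqP := muP j0; rewrite yj0 mulr0 mulf_eq0 (negbTE x0).
by move/eqP.
Qed.

End Syzygy.

(** * Gluing along a line *)

Section Glue.
Variables (K : fieldType) (N : nat).
Local Notation E := 'rV[K]_N.
Implicit Types (v w x e f h : E) (Z : 'M[K]_N) (U V L M : {vspace E}).
Implicit Types (X A B s t : seq E) (G : 'Hom(E, 'M[K]_N)).

Lemma subwE G h x : (G - wedger h) x = G x - wedge x h.
Proof. by rewrite add_lfunE opp_lfunE wedgerE. Qed.

Lemma syz_sub X G h : h \in <<X>>%VS -> syz X G -> syz X (G - wedger h).
Proof.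
move=> hX sG x /sG[k kX Gx]; exists (k - h); first exact: memvB.
by rewrite subwE Gx wedgeBr.
Qed.

Lemma trivial_sub X G h : h \in <<X>>%VS -> ~ trivial X G -> ~ trivial X (G - wedger h).
Proof.
move=> hX nt [k kX Gk]; apply: nt; exists (k + h); first exact: memvD.
by move=> x /Gk; rewrite subwE wedgeDr => /eqP; rewrite subr_eq => /eqP.
Qed.

Lemma nontrivial_neq0 X G : ~ trivial X G -> exists2 x, x \in X & G x != 0.
Proof.
move=> nt; have [/allP G0|/allPn//] := boolP (all (fun x => G x == 0) X).
by case: nt; exists 0; [exact: mem0v|move=> x /G0/eqP->; rewrite wedge0r].
Qed.

(** Together with [syz_alt] this places the values of [G] on the span of [X] in the exterior square
    of that span. *)
Lemma syz_projm X G : syz X G -> {in <<X>>%VS, forall w, G w *m projm <<X>> = 0}.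
Proof.
move=> sG; apply: span_ind; first by rewrite linear0 mul0mx.
  by move=> a u v Hu Hv; rewrite linearP mulmxDl -scalemxAl Hu Hv scaler0 addr0.
move=> x xX; have [h hX ->] := sG x xX; rewrite /wedge mulmxBl -!mulmxA.
have /eqP-> : h *m projm <<X>> == 0 by rewrite projm_eq0.
have /eqP-> : x *m projm <<X>> == 0 by rewrite projm_eq0 memv_span.
by rewrite !mulmx0 subrr.
Qed.

Lemma syz_alt X G : syz X G -> {in <<X>>%VS, forall w, alt (G w)}.
Proof.
move=> sG; apply: span_ind; first by move=> x; rewrite linear0 mulmx0 mul0mx.
  by move=> a u v Hu Hv; rewrite linearP; apply: alt_lin.
by move=> x xX; have [h hX ->] := sG x xX; apply: wedge_alt.
Qed.

Lemma row_projm Z L x : Z *m projm L = 0 -> x *m Z \in L.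
Proof. by move=> ZL; rewrite -projm_eq0 -mulmxA ZL mulmx0. Qed.

(** The exterior square of a line is zero: [Z] is a column times [e], and alternation against a
    functional dual to [e] kills that column. *)
Lemma alt_line Z (e : E) : alt Z -> (forall x, x *m Z \in <[e]>%VS) -> Z = 0.
Proof.
move=> aZ Ze; have [e0|e0] := eqVneq e 0.
  apply/row_matrixP=> i; rewrite rowE row0; have := Ze (delta_mx 0 i).
  by rewrite e0 => /vlineP[a ->]; rewrite scaler0.
have [c ec] := rV_neq0 e0.
have Zs : Z = (Z *m c) *m e.
  apply/row_matrixP=> i; rewrite !rowE; have /vlineP[a Ea] := Ze (delta_mx 0 i).
  by rewrite !mulmxA Ea -scalemxAl ec -scalemxAl mul1mx.
have cZ : c^T *m Z = 0.
  by rewrite Zs mulmxA mulmxA; have := aZ c^T; rewrite trmxK => ->; rewrite mul0mx.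
have Zc : Z *m c = 0.
  by apply: trmx_inj; rewrite trmx_mul (alt_tr aZ) mulmxN cZ oppr0 trmx0.
by rewrite Zs Zc mul0mx.
Qed.

(** The vector [g] is the contraction of [Z] with a functional [c] dual to [f]. Then [c] kills
    [Z - wedge f g], whose rows therefore lie in the line cut out by [c], and [alt_line] applies. *)
Lemma alt_plane Z (e f : E) : f != 0 -> alt Z ->
    (forall x, x *m Z \in <<[:: e; f]>>%VS) ->
  exists2 g, g \in <<[:: e; f]>>%VS & Z = wedge f g.
Proof.
move=> f0 aZ Zef; have [c fc] := rV_neq0 f0.
have [g gE] : exists g, g = c^T *m Z by eexists.
have gef : g \in <<[:: e; f]>>%VS by rewrite gE.
have fef : f \in <<[:: e; f]>>%VS by rewrite memv_span // !inE eqxx orbT.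
exists g => //; apply/eqP; rewrite -subr_eq0; apply/eqP.
have gc : g *m c = 0 by have := aZ c^T; rewrite trmxK gE.
have aZ' : alt (Z - wedge f g).
  by rewrite addrC -scaleN1r; apply: alt_lin => //; apply: wedge_alt.
have cZ' : c^T *m (Z - wedge f g) = 0.
  rewrite mulmxBr -gE /wedge mulmxBr !mulmxA -!trmx_mul fc gc trmx1 trmx0.
  by rewrite mul1mx mul0mx subr0 subrr.
apply: (alt_line (e := e - (e *m c) 0 0 *: f)) => // x.
have Z'c : (Z - wedge f g) *m c = 0.
  by apply: trmx_inj; rewrite trmx_mul (alt_tr aZ') mulmxN cZ' oppr0 trmx0.
have /cons_coord[a [y]] : x *m (Z - wedge f g) \in <<[:: e; f]>>%VS.
  rewrite mulmxBr memvB // /wedge mulmxBr !mulmxA !mulmx11.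
  by rewrite memvB // memvZ.
rewrite big_ord1 /= => E1; move: (congr1 (mulmx^~ c) E1).
rewrite -mulmxA Z'c mulmx0 mulmxDl -!scalemxAl fc => /(congr1 (fun A : 'M_1 => A 0 0)).
rewrite !mxE mulr1n mulr1 => /esym/eqP; rewrite addrC addr_eq0 => /eqP yE.
apply/vlineP; exists a; rewrite E1 yE scalerBr scalerA scaleNr.
by [].
Qed.

(** The induction hypothesis of [sep_ind], named so that the gluing lemmas can assume it. *)
Definition smaller d := forall X G, (\dim <<X>>%VS < d)%N ->
  syz X G -> ~ trivial X G -> circuit X -> sep X.

Lemma dim_plane e f : free [:: e; f] -> \dim <<[:: e; f]>>%VS = 2%N.
Proof.
move=> fef; apply: (vector.size_basis (X := [tuple e; f])).
by rewrite /basis_of fef eqxx.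
Qed.

Lemma dim_addv_cap2 (P M : {vspace E}) e f : free [:: e; f] ->
  e \in P -> f \in P -> e \in M -> f \in M ->
  (\dim (P + M) + 2 <= \dim P + \dim M)%N.
Proof.
move=> fef eP fP eM fM; rewrite -dimv_sum_cap leq_add2l.
suff /dimvS : (<<[:: e; f]>> <= P :&: M)%VS by rewrite dim_plane.
by apply/span_subvP => x; rewrite !inE memv_cap => /pred2P[]->; apply/andP.
Qed.

Lemma dim_addv_cap1 (P M : {vspace E}) e : e != 0 ->
  e \in P -> e \in M -> (\dim (P + M) < \dim P + \dim M)%N.
Proof.
move=> e0 eP eM; rewrite -dimv_sum_cap -addn1 leq_add2l.
suff /dimvS : (<[e]> <= P :&: M)%VS by rewrite dim_vline e0.
by rewrite -memvE memv_cap eP.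
Qed.

(** Add to [A] the points [e], [f], [e + f], at which [G] vanishes: they form a circuit and keep [G]
    nontrivial, so induction separates the enlarged set. Two of the three points fall in the same
    piece, which then contains their span and absorbs [M] at a cost of [\dim M - 2]. *)
Lemma descend X G A M e f : smaller (\dim <<X>>%VS) ->
    {in X, forall x, x \in A \/ x \in M} ->
    e \in <<A>>%VS -> f \in <<A>>%VS -> e \in M -> f \in M -> free [:: e; f] ->
    (\dim <<A>> + \dim M <= (\dim <<X>>%VS).+2)%N -> (\dim <<A>> < \dim <<X>>%VS)%N ->
    syz A G -> G e = 0 -> G f = 0 -> (exists2 a, a \in A & G a != 0) ->
  sep X.
Proof.
move=> IH XAM eA fA eM fM fef dAM dA sA Ge Gf [a aA Ga].
pose Y := A ++ [:: e; f; e + f].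
have spY : <<Y>>%VS = <<A>>%VS.
  rewrite span_cat; apply/addv_idPl/span_subvP => x.
  by rewrite !inE => /or3P[]/eqP-> //; apply: memvD.
have AY : {subset A <= Y} by move=> x; rewrite mem_cat => ->.
have sepY : sep Y.
  apply: (IH Y G); rewrite ?spY //.
  - move=> x; rewrite mem_cat => /orP[/sA|xY]; first by rewrite spY.
    exists 0; first exact: mem0v.
    rewrite wedge0r; move: xY; rewrite !inE => /or3P[]/eqP-> //.
    by rewrite linearD /= Ge Gf addr0.
  - case=> h hA Gh; case/eqP: Ga.
    have e0 : e != 0 by apply: (free_not0 fef); rewrite mem_head.
    have f0 : f != 0 by apply: (free_not0 fef); rewrite !inE eqxx orbT.
    have we : wedge e h = 0 by rewrite -Gh ?Ge // mem_cat !inE eqxx orbT.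
    have wf : wedge f h = 0 by rewrite -Gh ?Gf // mem_cat !inE eqxx !orbT.
    have /vlineP[k hk] := wedge_eq0 e0 we.
    have /vlineP[l hl] := wedge_eq0 f0 wf.
    rewrite Gh ?AY //; suff -> : h = 0 by rewrite wedge0r.
    move: fef; rewrite free_cons => /andP[ef _]; have [k0|k0] := eqVneq k 0.
      by rewrite hk k0 scale0r.
    case/negP: ef; rewrite span_seq1; apply/vlineP; exists (k^-1 * l).
    by rewrite -scalerA -hl hk scalerA mulVf // scale1r.
  - exists 2, (fun i => if i == 0 then e else f), (fun=> 1); split.
    (* If [A] spanned only the plane of [e] and [f], then [G] would vanish on all of [A]. *)
    + rewrite /= spY ltnNge; apply/negP => dA2; case/eqP: Ga.
      have : a \in <<[:: e; f]>>%VS.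
        have /eqP<- : <<A>>%VS == <<[:: e; f]>>%VS.
          rewrite eq_sym eqEdim; apply/andP; split.
            by apply/span_subvP => x; rewrite !inE => /pred2P[]->.
          by rewrite dim_plane.
        exact: memv_span.
      apply: (span_ind (P := fun x => G x = 0)); first exact: linear0.
        by move=> k u v Gu Gv; rewrite linearP /= Gu Gv scaler0 addr0.
      by move=> x; rewrite !inE => /pred2P[]->.
    + move=> b Hb; have /cons_coord_inj := fef => /(_ (b 0) (fun i => b 1)).
      rewrite big_ord1 /=; move: Hb; rewrite !big_ord_recl big_ord0 addr0 /= => Hb.
      have -> : 1 = lift ord0 ord0 :> 'I_2 by apply: val_inj.
      case/(_ Hb) => b0 b1 i; case: (unliftP ord0 i) => [j ->|-> //].
      by rewrite ord1 (b1 0).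
    + move=> i; rewrite mem_cat !inE; case: eqP => _; rewrite eqxx ?orbT //.
    + by move=> i; apply: oner_neq0.
    + rewrite !big_ord_recl big_ord0 addr0 /= !scale1r mem_cat !inE eqxx !orbT //.
have aux (P Q : {vspace E}) : {in Y, forall x, x \in P \/ x \in Q} ->
    (\dim P + \dim Q <= (\dim <<Y>>%VS).+1)%N ->
    (\dim P < \dim <<Y>>%VS)%N -> (\dim Q < \dim <<Y>>%VS)%N ->
    e \in P -> f \in P -> sep X.
  rewrite spY => cY dPQ dP dQ eP fP; exists (P + M)%VS, Q.
  have d2 := dim_addv_cap2 fef eP fP eM fM.
  split; [|dlia..].
  move=> x /XAM[/AY/cY[xP|]|xM]; [left|by right|left].
    by apply: (subvP (addvSl _ _)).
  by apply: (subvP (addvSr _ _)).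
have [P [Q [cY dPQ dP dQ]]] := sepY.
have cY' : {in Y, forall x, x \in Q \/ x \in P} by move=> x /cY[]; [right|left].
have dQP : (\dim Q + \dim P <= (\dim <<Y>>%VS).+1)%N by rewrite addnC.
have inY x : x \in [:: e; f; e + f] -> x \in Y by rewrite mem_cat orbC => ->.
have efE : f = (e + f) - e by rewrite addrAC subrr add0r.
have feE : e = (e + f) - f by rewrite addrK.
have [||eP] := cY e; first by apply: inY; rewrite mem_head.
  move=> eP; have [||fQ] := cY f; first by apply: inY; rewrite !inE eqxx orbT.
    by move=> fP; apply: (aux P Q).
  have [||efQ] := cY (e + f); first by apply: inY; rewrite !inE eqxx !orbT.
    by move=> efP; apply: (aux P Q) => //; rewrite efE memvB.
  by apply: (aux Q P) => //; rewrite feE memvB.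
have [||fQ] := cY f; first by apply: inY; rewrite !inE eqxx orbT.
  move=> fP; have [||efQ] := cY (e + f); first by apply: inY; rewrite !inE eqxx !orbT.
    by move=> efP; apply: (aux P Q) => //; rewrite feE memvB.
  by apply: (aux Q P) => //; rewrite efE memvB.
by apply: (aux Q P).
Qed.

(* For c in K^N, [contract L G c] maps w to the contraction of G w with a
   functional vanishing on L; every point of X on L is an eigenvector of it. *)
Definition contract L G (c : 'cV[K]_N) : 'End(E) :=
  linfun (trmx \o (mulmxr (projm L *m c) \o G)).

Lemma contractE L G c w : contract L G c w = (G w *m (projm L *m c))^T.
Proof. by rewrite lfunE. Qed.

Lemma contract_wedge L G c a h : a \in L -> G a = wedge a h ->
  contract L G c a = (h *m projm L *m c) 0 0 *: a.
Proof.
move=> aL Ga; rewrite contractE Ga /wedge mulmxBl -!mulmxA [a *m _]mulmxA.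
have /eqP-> : a *m projm L == 0 by rewrite projm_eq0.
by rewrite mul0mx mulmx0 subr0 trmx_mul trmxK mulmx11 [_^T _ _]mxE mulmxA.
Qed.

(** The points of [A] are eigenvectors of every contraction. If all of them have the eigenvalues of
    one nonzero [a0], their vectors [h] agree modulo the span. Otherwise some contraction, shifted
    by its eigenvalue at [a0], has [a0] in its kernel and a nonzero image; each point of [A] lies in
    the kernel or in the image, and rank-nullity bounds the dimensions. *)
Lemma conn X G A : syz X G -> {subset A <= X} ->
  (exists N1 N2 : {vspace E}, [/\ {in A, forall a, a \in N1 \/ a \in N2},
     (\dim N1 + \dim N2 <= \dim <<A>>%VS)%N, (0 < \dim N1)%N & (0 < \dim N2)%N]) \/
  (exists2 h0, h0 \in <<X>>%VS & {in A, forall a, exists2 h,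
     h - h0 \in <<A>>%VS & G a = wedge a h}).
Proof.
move=> sG AX; set L := <<A>>%VS.
have [A0|/allPn[a0 a0A a0n]] := boolP (all (pred1 0) A).
  right; exists 0; first exact: mem0v.
  move=> a aA; exists 0; first by rewrite subr0 mem0v.
  by rewrite (eqP (allP A0 _ aA)) linear0 wedge0r.
have [h0 h0X Ga0] := sG _ (AX _ a0A).
pose eig a := [forall j : 'I_N, contract L G (delta_mx j 0) a ==
  (h0 *m projm L *m (delta_mx j 0 : 'cV_N)) 0 0 *: a].
have [H|/allPn[a1 a1A /forallPn[j Hj]]] := boolP (all eig A).
  right; exists h0 => // a aA; have [h hX Ga] := sG _ (AX _ aA).
  have [a00|a00] := eqVneq a 0.
    by exists h0; rewrite ?subrr ?mem0v // a00 linear0 wedge0l.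
  exists h => //; rewrite -projm_eq0 mulmxBl subr_eq0; apply/eqP/rowP=> j.
  have /forallP/(_ j)/eqP := allP H _ aA.
  rewrite (contract_wedge _ (memv_span aA) Ga) -!colE !mxE => /eqP.
  rewrite -subr_eq0 -scalerBl scaler_eq0 (negbTE a00) orbF subr_eq0 => /eqP E1.
  done.
left; set mu := (h0 *m projm L *m (delta_mx j 0 : 'cV_N)) 0 0 in Hj.
pose T := contract L G (delta_mx j 0) - mu *: \1%VF.
have TE w : T w = contract L G (delta_mx j 0) w - mu *: w.
  by rewrite add_lfunE opp_lfunE scale_lfunE id_lfunE.
exists (L :&: lker T)%VS, (T @: L)%VS; split.
- move=> a aA; have [h hX Ga] := sG _ (AX _ aA).
  have aL : a \in L by apply: memv_span.
  have Ta : T a = ((h *m projm L *m (delta_mx j 0 : 'cV_N)) 0 0 - mu) *: a.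
    by rewrite TE (contract_wedge _ aL Ga) scalerBl.
  have [l0|l0] := eqVneq ((h *m projm L *m (delta_mx j 0 : 'cV_N)) 0 0 - mu) 0.
    by left; rewrite memv_cap aL memv_ker Ta l0 scale0r eqxx.
  by right; rewrite -[a](scalerK l0) -Ta memvZ // memv_img.
- by rewrite limg_ker_dim.
- rewrite lt0n dimv_eq0; apply: contraNneq a0n => L0; rewrite /= -memv0 -L0.
  rewrite memv_cap memv_span // memv_ker TE (contract_wedge _ (memv_span a0A) Ga0).
  by rewrite subrr eqxx.
rewrite lt0n dimv_eq0; apply: contraNneq Hj => L0.
by rewrite -subr_eq0 -TE -memv0 -L0 memv_img // memv_span.
Qed.

(** Writing [hA - hB = l + m] along the two spans, the vector [hA - l = hB + m] is congruent to [hA]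
    modulo the first span and to [hB] modulo the second. *)
Lemma adjust2 X G A B : {subset A <= X} -> {subset B <= X} ->
    (<<X>> <= <<A>> + <<B>>)%VS ->
    (exists2 h0, h0 \in <<X>>%VS & {in A, forall a, exists2 h,
       h - h0 \in <<A>>%VS & G a = wedge a h}) ->
    (exists2 h0, h0 \in <<X>>%VS & {in B, forall a, exists2 h,
       h - h0 \in <<B>>%VS & G a = wedge a h}) ->
  exists h, [/\ h \in <<X>>%VS, syz A (G - wedger h) & syz B (G - wedger h)].
Proof.
move=> AX BX XAB [hA hAX GA] [hB hBX GB].
have /(subvP XAB)/memv_addP[l lA [m mB lm]] : hA - hB \in <<X>>%VS by rewrite memvB.
exists (hA - l); split.
- by rewrite memvB //; apply: (subvP (sub_span AX)).
- move=> a aA; have [h hh Ga] := GA a aA; exists (h - hA + l); first by rewrite memvD.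
  by rewrite subwE Ga -wedgeBr opprB addrA addrAC.
- move=> a aB; have [h hh Ga] := GB a aB; exists (h - hB - m); first by rewrite memvB.
  have -> : hA - l = hB + m.
    by apply/eqP; rewrite subr_eq addrAC -addrA -lm addrC subrK.
  by rewrite subwE Ga -wedgeBr opprD addrA.
Qed.

Lemma cover_span X A B : {subset A <= X} -> {subset B <= X} ->
  {in X, forall x, x \in A \/ x \in B} -> (<<A>> + <<B>>)%VS = <<X>>%VS.
Proof.
move=> AX BX XAB; apply/eqP; rewrite eqEsubv; apply/andP; split.
  by rewrite subv_add !sub_span.
apply/span_subvP => x /XAB[xA|xB].
  by apply/(subvP (addvSl _ _))/memv_span.
by apply/(subvP (addvSr _ _))/memv_span.
Qed.

(** The two spans meet in a plane. Trivial maps are subtracted until [G] vanishes on this plane, and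
    then [descend] applies. *)
Lemma glue2 X G A B e : smaller (\dim <<X>>%VS) -> syz X G -> ~ trivial X G ->
    {subset A <= X} -> {subset B <= X} -> {in X, forall x, x \in A \/ x \in B} ->
    e \in A -> e \in B -> e != 0 ->
    (\dim <<A>> + \dim <<B>> = (\dim <<X>>%VS).+2)%N ->
    (\dim <<A>> < \dim <<X>>%VS)%N -> (\dim <<B>> < \dim <<X>>%VS)%N ->
    syz A G -> syz B G -> sep X.
Proof.
move=> IH sG nt AX BX XAB eA eB e0 dAB dA dB sA sB.
have spAB := cover_span AX BX XAB.
have dcap : \dim (<<A>> :&: <<B>>)%VS = 2%N.
  by have := dimv_sum_cap <<A>>%VS <<B>>%VS; rewrite spAB; dlia.
have eL := memv_span eA; have eM := memv_span eB.
have [k kL Gk] := sA e eA.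
have kM : k \in <<B>>%VS.
  have [l lM Gl] := sB e eB; rewrite -[k](subrK l) memvD //.
  have : k - l \in <[e]>%VS by apply: wedge_line; rewrite // -Gk.
  by apply: subvP; rewrite -memvE.
have kX : k \in <<X>>%VS by apply: (subvP (sub_span AX)).
have [f fAB fe] : exists2 f, f \in (<<A>> :&: <<B>>)%VS & f \notin <[e]>%VS.
  apply/subvPn; apply/negP => /dimvS; rewrite dcap dim_vline; case: (e != 0) => //.
have /andP[fL fM] : (f \in <<A>>%VS) && (f \in <<B>>%VS) by rewrite -memv_cap.
have fef : free [:: f; e] by rewrite free_cons span_seq1 fe seq1_free.
have fef' : free [:: e; f].
  by rewrite (@perm_free _ _ _ [:: f; e]) // (perm_catC [:: e] [:: f]).
have f0 : f != 0 by apply: (free_not0 fef); rewrite mem_head.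
have efE : <<[:: e; f]>>%VS = (<<A>> :&: <<B>>)%VS.
  apply/eqP; rewrite eqEdim dcap dim_plane // leqnn andbT.
  by apply/span_subvP=> x; rewrite !inE => /pred2P[]->; rewrite memv_cap ?fL ?fM ?eL.
pose G1 := G - wedger k.
have sA1 : syz A G1 by apply: syz_sub.
have sB1 : syz B G1 by apply: syz_sub.
have G1e : G1 e = 0 by rewrite subwE Gk subrr.
(* [G1 f] lies in the exterior squares of both spans, hence in that of their intersection. *)
have [g gef G1f] : exists2 g, g \in <<[:: e; f]>>%VS & G1 f = wedge f g.
  apply: alt_plane => //; first exact: (syz_alt sA1).
  move=> x; rewrite efE memv_cap; apply/andP; split.
    by apply/row_projm/(syz_projm sA1).
  by apply/row_projm/(syz_projm sB1).
have [a [y gE]] := cons_coord gef.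
have aeL : a *: e \in <<A>>%VS by rewrite memvZ.
have aeM : a *: e \in <<B>>%VS by rewrite memvZ.
have aeX : a *: e \in <<X>>%VS by apply: (subvP (sub_span AX)).
pose G2 := G1 - wedger (a *: e).
have sA2 : syz A G2 by apply: syz_sub.
have sB2 : syz B G2 by apply: syz_sub.
have G2e : G2 e = 0 by rewrite subwE G1e wedgeZr wedgevv scaler0 subrr.
have G2f : G2 f = 0.
  rewrite subwE G1f gE big_ord1 /= wedgeDr [wedge f (y _ *: _)]wedgeZr wedgevv.
  by rewrite scaler0 addr0 subrr.
have nt2 : ~ trivial X G2 by do 2!apply: trivial_sub => //.
have [x xX G2x] := nontrivial_neq0 nt2.
have [xA|xB] := XAB x xX.
  apply: (@descend X G2 A <<B>>%VS e f) => //; [|by rewrite dAB|by exists x].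
  by move=> z /XAB[]; [left|right; apply: memv_span].
apply: (@descend X G2 B <<A>>%VS e f) => //; [|by rewrite addnC dAB|by exists x].
by move=> z /XAB[]; [right; apply: memv_span|left].
Qed.

End Glue.

(** * Gluing with one point set aside *)

Section Glue2.
Variables (K : fieldType) (N : nat).
Local Notation E := 'rV[K]_N.
Implicit Types (v w x e f h q : E) (Z : 'M[K]_N) (U V L M : {vspace E}).
Implicit Types (X A B s t : seq E) (G : 'Hom(E, 'M[K]_N)).

Lemma tensor_eq m1 m2 (u u' : 'rV[K]_m1) (v v' : 'rV[K]_m2) :
  u != 0 -> v != 0 -> u^T *m v' = u'^T *m v ->
  exists k, u' = k *: u /\ v' = k *: v.
Proof.
move=> u0 v0 uv; have [c uc] := rV_neq0 u0; have [d vd] := rV_neq0 v0.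
have v'E : v' = (u' *m c) 0 0 *: v.
  have := congr1 (mulmx c^T) uv; rewrite !mulmxA -!trmx_mul uc trmx1 mul1mx => ->.
  by rewrite mulmx11 mxE.
exists ((u' *m c) 0 0); split=> //.
apply: trmx_inj; rewrite -[u'^T]mulmx1 -vd mulmxA -uv v'E -scalemxAr -scalemxAl.
by rewrite -mulmxA vd mulmx1 linearZ.
Qed.

(** The pieces are [N1 + <<B>>] and [N2 + <[q]>]: the dimension saved at [e] in the first pays for
    [q] in the second. *)
Lemma sep_lines X A B (N1 N2 : {vspace E}) e q :
    e != 0 -> e \in N1 -> e \in <<B>>%VS ->
    {in X, forall x, [\/ x \in A, x \in B | x \in <[q]>%VS]} ->
    {in A, forall a, a \in N1 \/ a \in N2} ->
    (\dim N1 + \dim N2 <= \dim <<A>>%VS)%N -> (0 < \dim N2)%N ->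
    (\dim <<A>> + \dim <<B>> <= (\dim <<X>>%VS).+1)%N ->
    (\dim <<A>> < \dim <<X>>%VS)%N -> sep X.
Proof.
move=> e0 eN eB XAB AN dN dN2 dAB dA.
exists (N1 + <<B>>)%VS, (N2 + <[q]>)%VS.
have d1 := dim_addv_cap1 e0 eN eB.
have dN1 : (0 < \dim N1)%N.
  by rewrite lt0n dimv_eq0; apply: contraNneq e0 => N10; rewrite -memv0 -N10.
have d2 : (\dim (N2 + <[q]>) <= \dim N2 + 1)%N.
  by rewrite (leq_trans (dimv_add_leqif _ _)) // leq_add2l dim_vline leq_b1.
split; [|dlia..].
move=> x /XAB[/AN[]xN|xB|xq].
- by left; apply: (subvP (addvSl _ _)).
- by right; apply: (subvP (addvSl _ _)).
- by left; apply/(subvP (addvSr _ _))/memv_span.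
- by right; apply: (subvP (addvSr _ _)).
Qed.

(** In the essential case the spans of [A] and [B] meet only in the line of [e], and [q = l + m]
    lies in neither. Once [G] is made to vanish at [e], [l] and [m], [descend] applies with [e], [l]
    on the side of [A] or with [e], [m] on the side of [B]. *)
Lemma glueQ X G A B e q : smaller K N (\dim <<X>>%VS) -> syz X G -> ~ trivial X G ->
    {subset A <= X} -> {subset B <= X} -> q \in X ->
    {in X, forall x, [\/ x \in A, x \in B | x \in <[q]>%VS]} ->
    e \in A -> e \in B -> e != 0 ->
    (\dim <<A>> + \dim <<B>> <= (\dim <<X>>%VS).+1)%N ->
    (\dim <<A>> < \dim <<X>>%VS)%N -> (\dim <<B>> < \dim <<X>>%VS)%N -> sep X.
Proof.
move=> IH sG nt AX BX qX XAB eA eB e0 dAB dA dB.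
have eL := memv_span eA; have eM := memv_span eB.
have inAB x : x \in X -> (q \in <<A>>%VS) || (q \in <<B>>%VS) ->
    x \in <<A>>%VS \/ x \in <<B>>%VS.
  move=> /XAB[xA _|xB _|/vlineP[k ->] /orP[]]; first by left; apply: memv_span.
  - by right; apply: memv_span.
  - by left; apply: memvZ.
  - by right; apply: memvZ.
have [qAB|] := boolP ((q \in <<A>>%VS) || (q \in <<B>>%VS)).
  by exists <<A>>%VS, <<B>>%VS; split=> // x /inAB; apply.
rewrite negb_or => /andP[qA qB] {inAB}.
have XBA : {in X, forall x, [\/ x \in B, x \in A | x \in <[q]>%VS]}.
  by move=> x /XAB[]; [constructor 2|constructor 1|constructor 3].
have dBA : (\dim <<B>> + \dim <<A>> <= (\dim <<X>>%VS).+1)%N by rewrite addnC.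
have [[N1 [N2 [AN dN dN1 dN2]]]|hA] := conn sG AX.
  have [eN|eN] := AN e eA; first exact: (@sep_lines X A B N1 N2 e q).
  apply: (@sep_lines X A B N2 N1 e q) => //; last by rewrite addnC.
  by move=> a /AN[]; [right|left].
have [[N1 [N2 [BN dN dN1 dN2]]]|hB] := conn sG BX.
  have [eN|eN] := BN e eB; first exact: (@sep_lines X B A N1 N2 e q).
  apply: (@sep_lines X B A N2 N1 e q) => //; last by rewrite addnC.
  by move=> a /BN[]; [right|left].
have LMX : (<<A>> + <<B>> <= <<X>>)%VS by rewrite subv_add !sub_span.
have dim_e : \dim <[e]> = 1%N by rewrite dim_vline e0.
have dA1 : (0 < \dim <<A>>)%N.
  by move: eL; rewrite memvE => /dimvS; rewrite dim_e.
have [XLM|nXLM] := boolP (<<X>> <= <<A>> + <<B>>)%VS; last first.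
  exists (<<A>> + <<B>>)%VS, <[q]>%VS.
  have d1 : (\dim (<<A>> + <<B>>) < \dim <<X>>)%N.
    by rewrite (ltn_leqif (dimv_leqif_sup LMX)).
  have d2 : (\dim <[q]> <= 1)%N by rewrite dim_vline leq_b1.
  split; [|dlia..].
  move=> x /XAB[xA|xB|xq]; last by right.
    by left; apply/(subvP (addvSl _ _))/memv_span.
  by left; apply/(subvP (addvSr _ _))/memv_span.
have [h [hX sA sB]] := adjust2 AX BX XLM hA hB.
have spX : <<X>>%VS = (<<A>> + <<B>>)%VS by apply/eqP; rewrite eqEsubv XLM.
pose G1 := G - wedger h.
have sG1 : syz X G1 by apply: syz_sub.
have capE : (<<A>> :&: <<B>>)%VS = <[e]>%VS.
  apply/eqP; rewrite eq_sym eqEdim -memvE memv_cap eL eM /= dim_e.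
  by have := dimv_sum_cap <<A>>%VS <<B>>%VS; rewrite -spX; dlia.
have G1e : G1 e = 0.
  have [k kL Gk] := sA e eA; have [l lM Gl] := sB e eB.
  have : k \in (<<A>> :&: <<B>>)%VS.
    rewrite memv_cap kL -[k](subrK l) memvD //.
    have : k - l \in <[e]>%VS by apply: wedge_line; rewrite // -Gk.
    by apply: subvP; rewrite -memvE.
  by rewrite capE Gk => /vlineP[c ->]; rewrite wedgeZr wedgevv scaler0.
have [l lL [m mM qlm]] : exists2 l, l \in <<A>>%VS & exists2 m, m \in <<B>>%VS & q = l + m.
  by apply/memv_addP; rewrite -spX memv_span.
have tr_proj C w : syz C G1 -> w \in <<C>>%VS -> (projm <<C>>)^T *m G1 w = 0.
  move=> sC wC; apply: trmx_inj; rewrite trmx_mul trmxK (alt_tr (syz_alt sC wC)).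
  by rewrite mulNmx (syz_projm sC wC) oppr0 trmx0.
have [k kX G1q] := sG1 q qX.
(* [G1 l] and [G1 m] are bivectors of the two spans, so [G1 q] has no component in the tensor
   product of the two quotients. For [G1 q = wedge q k] this makes [k] the same multiple of [q]
   modulo either span. *)
have : (projm <<A>>)^T *m G1 q *m projm <<B>> = 0.
  rewrite qlm linearD mulmxDr mulmxDl tr_proj // mul0mx add0r.
  by rewrite -mulmxA (syz_projm sB) // mulmx0.
rewrite G1q /wedge mulmxBr mulmxBl => /eqP; rewrite subr_eq0 => /eqP.
rewrite !mulmxA -!trmx_mul -!(mulmxA _ _ (projm <<B>>)) => /tensor_eq.
rewrite !projm_eq0 => /(_ qA qB)[c [kA kB]].
have : k - c *: q \in (<<A>> :&: <<B>>)%VS.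
  by rewrite memv_cap -!projm_eq0 !mulmxBl kA kB -!scalemxAl !subrr eqxx.
rewrite capE => /vlineP[c' kE].
have ceL : c' *: e \in <<A>>%VS by rewrite memvZ.
have ceM : c' *: e \in <<B>>%VS by rewrite memvZ.
have ceX : c' *: e \in <<X>>%VS by apply: (subvP (sub_span AX)).
pose G2 := G1 - wedger (c' *: e).
have sA2 : syz A G2 by apply: syz_sub.
have sB2 : syz B G2 by apply: syz_sub.
have G2e : G2 e = 0 by rewrite subwE G1e wedgeZr wedgevv scaler0 subrr.
have G2q : G2 q = 0.
  by rewrite subwE G1q -wedgeBr -kE opprB addrCA subrr addr0 wedgeZr wedgevv scaler0.
have G2lm : G2 l = - G2 m.
  by move/eqP: G2q; rewrite qlm linearD addr_eq0 => /eqP.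
(* [G2 l = - G2 m] lies in the exterior squares of both spans, hence in that of the line of [e],
   which is zero. *)
have G2l : G2 l = 0.
  apply: (@alt_line _ _ _ e); first exact: (syz_alt sA2).
  move=> x; rewrite -capE memv_cap; apply/andP; split.
    by apply/row_projm/(syz_projm sA2).
  by rewrite G2lm mulmxN memvN; apply/row_projm/(syz_projm sB2).
have G2m : G2 m = 0 by apply/eqP; rewrite -oppr_eq0 -G2lm G2l.
have nt2 : ~ trivial X G2 by apply: trivial_sub => //; apply: trivial_sub.
have lM : l \notin <<B>>%VS.
  by apply: contra qB => lM; rewrite qlm memvD.
have mL : m \notin <<A>>%VS.
  by apply: contra qA => mL; rewrite qlm memvD.
have fr (z : E) : z \notin <[e]>%VS -> free [:: e; z].
  move=> ze; rewrite (@perm_free _ _ _ [:: z; e]) ?(perm_catC [:: e] [:: z]) //.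
  by rewrite free_cons span_seq1 ze seq1_free.
have fel : free [:: e; l].
  by apply: fr; apply: contra lM; apply: subvP; rewrite -memvE.
have fem : free [:: e; m].
  by apply: fr; apply: contra mL; apply: subvP; rewrite -memvE.
have dq (U : {vspace E}) : (\dim (U + <[q]>) <= \dim U + 1)%N.
  by rewrite (leq_trans (dimv_add_leqif _ _)) // leq_add2l dim_vline leq_b1.
have lq : l = q - m by rewrite qlm addrK.
have mq : m = q - l by rewrite qlm addrC addKr.
have qq U : q \in (U + <[q]>)%VS by apply/(subvP (addvSr _ _))/memv_line.
have UU (U : {vspace E}) z : z \in U -> z \in (U + <[q]>)%VS.
  exact: (subvP (addvSl _ _)).
have [x xX G2x] := nontrivial_neq0 nt2.
have [xA|xB|/vlineP[k' xq]] := XAB x xX.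
- have d1 := dq <<B>>%VS.
  apply: (@descend _ _ X G2 A (<<B>> + <[q]>)%VS e l) => //.
  + move=> z /XAB[zA|zB|zq]; [by left|right..].
      exact/UU/memv_span.
    exact/(subvP (addvSr _ _)).
  + exact: UU.
  + by rewrite lq memvB // UU.
  + by dlia.
  + by exists x.
- have d1 := dq <<A>>%VS.
  apply: (@descend _ _ X G2 B (<<A>> + <[q]>)%VS e m) => //.
  + move=> z /XAB[zA|zB|zq]; [right|by left|right].
      exact/UU/memv_span.
    exact/(subvP (addvSr _ _)).
  + exact: UU.
  + by rewrite mq memvB // UU.
  + by dlia.
  + by exists x.
by case/eqP: G2x; rewrite xq linearZ /= G2q scaler0.
Qed.

(** If [\dim N2 > 1], then [N1 + <<B>>] and [N2] separate [X], thanks to the dimension saved at [e].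
    If [N2] is a line, its point [q] is set aside and [glueQ] applies to the points of [A] in
    [N1]. *)
Lemma glue_conn X G A B (N1 N2 : {vspace E}) e :
    smaller K N (\dim <<X>>%VS) -> syz X G -> ~ trivial X G ->
    {subset A <= X} -> {subset B <= X} -> {in X, forall x, x \in A \/ x \in B} ->
    e \in A -> e \in B -> e != 0 ->
    (\dim <<A>> + \dim <<B>> <= (\dim <<X>>%VS).+2)%N ->
    (\dim <<A>> < \dim <<X>>%VS)%N -> (\dim <<B>> < \dim <<X>>%VS)%N ->
    e \in N1 -> {in A, forall a, a \in N1 \/ a \in N2} ->
    (\dim N1 + \dim N2 <= \dim <<A>>%VS)%N -> (0 < \dim N2)%N ->
  sep X.
Proof.
move=> IH sG nt AX BX XAB eA eB e0 dAB dA dB eN AN dN dN2.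
have eM := memv_span eB.
have [N2gt1|N2le1] := ltnP 1 (\dim N2).
  exists (N1 + <<B>>)%VS, N2; have d1 := dim_addv_cap1 e0 eN eM.
  split; [|dlia..].
  move=> x /XAB[/AN[]xN|xB]; [left|by right|left].
    by apply: (subvP (addvSl _ _)).
  by apply/(subvP (addvSr _ _))/memv_span.
have [/allP AN1|/allPn[q qA qN1]] := boolP (all (fun a => a \in N1) A).
  have /dimvS dA1 : (<<A>> <= N1)%VS by apply/span_subvP.
  by dlia.
have qN2 : q \in N2 by case: (AN q qA) => // qN; rewrite qN in qN1.
have q0 : q != 0 by apply: contraNneq qN1 => ->; apply: mem0v.
have N2E : N2 = <[q]>%VS.
  apply/eqP; rewrite eq_sym eqEdim -memvE qN2 /=.
  by rewrite dim_vline q0 (leq_trans N2le1).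
pose A1 := [seq a <- A | a \in N1].
have /dimvS dA1 : (<<A1>> <= N1)%VS.
  by apply/span_subvP=> a; rewrite mem_filter => /andP[].
apply: (@glueQ X G A1 B e q) => //.
- by move=> a; rewrite mem_filter => /andP[_ /AX].
- exact: AX.
- move=> x /XAB[xA|xB]; last by constructor 2.
  case: (AN x xA) => xN; last by constructor 3; rewrite -N2E.
  by constructor 1; rewrite mem_filter xN.
- by rewrite mem_filter eN.
- by dlia.
- by dlia.
Qed.

Lemma glue X G A B e : smaller K N (\dim <<X>>%VS) -> syz X G -> ~ trivial X G ->
    {subset A <= X} -> {subset B <= X} -> {in X, forall x, x \in A \/ x \in B} ->
    e \in A -> e \in B -> e != 0 ->
    (\dim <<A>> + \dim <<B>> <= (\dim <<X>>%VS).+2)%N ->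
    (\dim <<A>> < \dim <<X>>%VS)%N -> (\dim <<B>> < \dim <<X>>%VS)%N ->
  sep X.
Proof.
move=> IH sG nt AX BX XAB eA eB e0 dAB dA dB.
have XBA : {in X, forall x, x \in B \/ x \in A} by move=> x /XAB[]; [right|left].
have dBA : (\dim <<B>> + \dim <<A>> <= (\dim <<X>>%VS).+2)%N by rewrite addnC.
have [dle|dgt] := leqP (\dim <<A>> + \dim <<B>>) (\dim <<X>>%VS).+1.
  exists <<A>>%VS, <<B>>%VS; split=> // x /XAB[xA|xB]; [left|right]; exact: memv_span.
have [[N1 [N2 [AN dN dN1 dN2]]]|hA] := conn sG AX.
  have [eN|eN] := AN e eA; first exact: (@glue_conn X G A B N1 N2 e).
  apply: (@glue_conn X G A B N2 N1 e) => //; last by rewrite addnC.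
  by move=> a /AN[]; [right|left].
have [[N1 [N2 [BN dN dN1 dN2]]]|hB] := conn sG BX.
  have [eN|eN] := BN e eB; first exact: (@glue_conn X G B A N1 N2 e).
  apply: (@glue_conn X G B A N2 N1 e) => //; last by rewrite addnC.
  by move=> a /BN[]; [right|left].
have [|h [hX sA sB]] := adjust2 AX BX _ hA hB; first by rewrite (cover_span AX BX XAB).
apply: (@glue2 _ _ X (G - wedger h) A B e) => //.
- exact: syz_sub.
- exact: trivial_sub.
- by apply/eqP; rewrite eqn_leq dAB dgt.
Qed.

End Glue2.

(** * Projection from a point *)

Section Main.
Variables (K : fieldType) (N : nat).
Local Notation E := 'rV[K]_N.
Implicit Types (v w x e f h q : E) (Z : 'M[K]_N) (U V L M : {vspace E}).
Implicit Types (X A B s t : seq E) (G : 'Hom(E, 'M[K]_N)).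

(** In a basis [a], [b] only the [b]-component of the vector for [a] and the [a]-component of the
    vector for [b] matter; their sum serves both. *)
Lemma trivial_dim2 X G : (\dim <<X>>%VS <= 2)%N -> syz X G -> trivial X G.
Proof.
move=> dX sG; have sub0 : {subset [::] <= X} by [].
have [s []] := free_extend (nil_free _) sub0.
rewrite /= => sX fs spX; have sz : (size s <= 2)%N.
  by rewrite -(vector.size_basis (X := in_tuple s) (U := <<X>>%VS)) // /basis_of fs spX eqxx.
case: s sz sX fs spX => [|a [|b [|//]]] _ sX fs spX.
- by exists 0; [exact: mem0v|exact: (syz_triv_basis spX)].
- have [h hX Ga] := sG a (sX _ (mem_head _ _)); exists h => //.
  by apply: (syz_triv_basis spX) => x; rewrite inE => /eqP->.
have bX : b \in X by apply: sX; rewrite !inE eqxx orbT.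
have aX : a \in X by apply: sX; rewrite mem_head.
have [ha haX Ga] := sG a aX; have [hb hbX Gb] := sG b bX.
have : ha \in <<[:: a; b]>>%VS by rewrite spX.
case/cons_coord=> x [y haE]; rewrite big_ord1 /= in haE.
have : hb \in <<[:: a; b]>>%VS by rewrite spX.
case/cons_coord=> x' [y' hbE]; rewrite big_ord1 /= in hbE.
exists (x' *: a + y 0 *: b); first by rewrite memvD // memvZ // memv_span.
apply: (syz_triv_basis spX) => z; rewrite !inE => /pred2P[]->.
  by rewrite Ga haE !wedgeDr !wedgeZr wedgevv !scaler0.
by rewrite Gb hbE !wedgeDr !wedgeZr wedgevv !scaler0.
Qed.

Lemma scroll_ext X G (e h0 : E) k (b : 'I_k -> E) (c : 'I_k -> K) (x : K) :
    syz X G -> ~ trivial X G ->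
    e \in X -> (forall i, b i \in X) -> free (e :: mktuple b) ->
    h0 \in <<X>>%VS ->
    {in X, forall x, x \in <[e]>%VS \/ exists mu, G x = wedge x (h0 + mu *: e)} ->
    x *: e + \sum_i c i *: b i \in X -> (forall i, c i != 0) -> (0 < k)%N ->
    (if x == 0%R then 1 < k else k.+1 < \dim <<X>>%VS)%N ->
  sep X.
Proof.
move=> sG nt eX bX feb h0X qG PX c0 k0 hk.
have ebX : {subset e :: mktuple b <= X}.
  by move=> z; rewrite inE => /predU1P[->//|/mapP[i _ ->]].
have szm T (f : 'I_k -> T) : size (mktuple f) = k by apply: size_tuple.
have [t [tX ft spX]] := free_extend feb ebX.
have sz : (\dim <<X>>%VS = (k + size t).+1)%N.
  by rewrite -spX (eqnP ft) /= size_cat szm.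
pose y (i : 'I_(size (mktuple b ++ t))) := (mktuple c)`_i.
have szs : size (mktuple b ++ t) = (k + size t)%N by rewrite size_cat szm.
have lt0 : (0 < size (mktuple b ++ t))%N by rewrite szs ltn_addr.
(* The two indices for [scroll]: index 0 has a nonzero coefficient; the other is 1 if [x = 0], and
   otherwise [k], the first index past [c], where [nth] returns the default 0. *)
have lt1 : ((if x == 0%R then 1 else k) < size (mktuple b ++ t))%N.
  by rewrite szs; case: eqP hk => _; [move/ltn_addr; apply|rewrite sz ltnS].
apply: (@scroll _ _ X G e h0 (mktuple b ++ t)) => //.
  by move=> z; rewrite mem_cat => /orP[zb|/tX//]; apply: ebX; rewrite inE zb orbT.
exists x, y, (Ordinal lt1), (Ordinal lt0); split.
- suff -> : \sum_(i < size (mktuple b ++ t)) y i *: (mktuple b ++ t)`_i =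
      \sum_i c i *: b i by [].
  rewrite /y -(big_mkord xpredT (fun i => (mktuple c)`_i *: (mktuple b ++ t)`_i)).
  rewrite szs (big_cat_nat _ (leq_addr _ k)) //= [X in _ + X]big_nat_cond.
  rewrite [X in _ + X]big1 ?addr0 => [|i /andP[/andP[ki _] _]].
    rewrite big_mkord; apply: eq_bigr => i _.
    by rewrite nth_mktuple nth_cat szm ltn_ord nth_mktuple.
  by rewrite nth_default ?scale0r // szm.
- by rewrite -val_eqE /=; case: (x == 0) => //; rewrite -lt0n.
- by rewrite /y /= (nth_mktuple _ _ (Ordinal k0)).
case: (eqVneq x 0) hk lt1 => [x0 k1 lt1|x0 kd lt1].
  by rewrite /y /= (nth_mktuple _ _ (Ordinal k1)).
by rewrite /y /= nth_default // szm.
Qed.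

Section Projection.
Variables (X : seq E) (G : 'Hom(E, 'M[K]_N)) (e : E).
Hypotheses (sG : syz X G) (eX : e \in X) (e0 : e != 0).

Definition pr : 'End(E) := (\1 - projv <[e]>)%VF.
(** Sandwiching a bivector between a matrix and its transpose applies the exterior square of that
    matrix ([wedge_mul]), so this is [G] taken modulo [e]. *)
Definition prG : 'Hom(E, 'M[K]_N) :=
  linfun (mulmxr (projm <[e]>%VS) \o (mulmx (projm <[e]>%VS)^T \o G)).

Lemma prE x : pr x = x *m projm <[e]>%VS.
Proof. by rewrite mul_projm add_lfunE opp_lfunE id_lfunE. Qed.

Lemma pr_eq0 x : (pr x == 0) = (x \in <[e]>%VS).
Proof. by rewrite prE projm_eq0. Qed.

Lemma pr_sub x : x - pr x \in <[e]>%VS.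
Proof. by rewrite add_lfunE opp_lfunE id_lfunE opprB addrC subrK memv_proj. Qed.

Lemma pre : pr e = 0.
Proof. by apply/eqP; rewrite pr_eq0 memv_line. Qed.

Lemma span_pr : <<map pr X>>%VS = (pr @: <<X>>)%VS.
Proof. by rewrite limg_span. Qed.

Lemma dim_pr : \dim <<X>>%VS = (\dim <<map pr X>>%VS).+1.
Proof.
rewrite span_pr -(limg_ker_dim pr).
suff -> : (<<X>> :&: lker pr)%VS = <[e]>%VS by rewrite dim_vline e0.
apply/vspaceP=> x; rewrite memv_cap memv_ker pr_eq0; apply/andb_idl => xe.
by apply: (subvP _ _ xe); rewrite -memvE memv_span.
Qed.

(** [x] and [pr x] differ by a multiple of [e], and [G e], being [e] wedged with some vector, dies
    modulo [e]. *)
Lemma prGE x h : G x = wedge x h -> prG (pr x) = wedge (pr x) (pr h).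
Proof.
move=> Gx; rewrite lfunE /= -[pr x in LHS](addrNK x) -opprB.
have /vlineP[k ->] := pr_sub x; have [he _ Ge] := sG eX.
rewrite addrC linearB linearZ /= mulmxBr mulmxBl Gx Ge -scalemxAr -scalemxAl.
by rewrite !wedge_mul -!prE pre wedge0l scaler0 subr0.
Qed.

Lemma syz_pr : syz (map pr X) prG.
Proof.
move=> _ /mapP[x xX ->]; have [h hX Gx] := sG xX.
by exists (pr h); [rewrite span_pr memv_img|exact: prGE].
Qed.

(** For [x] off the line of [e], equality modulo [e] gives [h = h0 + k *: x + mu *: e], whose term
    in [x] contributes nothing to [wedge x h]. *)
Lemma trivial_pr : trivial (map pr X) prG -> exists2 h0, h0 \in <<X>>%VS &
  {in X, forall x, x \in <[e]>%VS \/ exists mu, G x = wedge x (h0 + mu *: e)}.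
Proof.
case=> h'; rewrite span_pr => /memv_imgP[h0 h0X ->] Ht; exists h0 => // x xX.
have [|xe] := boolP (x \in <[e]>%VS); [by left|right].
have [h hX Gx] := sG xX; have := prGE Gx; rewrite (Ht _ (map_f _ xX)) => /esym.
move/wedge_line; rewrite pr_eq0 => /(_ xe)/vlineP[k Ek].
have : h - h0 - k *: x \in <[e]>%VS by rewrite -pr_eq0 !linearB linearZ /= Ek subrr.
case/vlineP=> mu Emu; exists mu; rewrite -Emu Gx addrA [h0 + _]addrC subrK.
by rewrite wedgeBr wedgeZr wedgevv scaler0 subr0.
Qed.

End Projection.

(** Since [e] is independent of the [b i], their images stay independent, and the term [x *: e]
    disappears. This covers a point [e] of the circuit as well as one outside its span. *)
Lemma circuit_pr X (e : E) k (b : 'I_k -> E) (c : 'I_k -> K) (x : K) :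
    e \in X -> e != 0 -> (1 < k)%N -> (k.+1 < \dim <<X>>%VS)%N ->
    free (e :: mktuple b) -> (forall i, b i \in X) -> (forall i, c i != 0) ->
    x *: e + \sum_i c i *: b i \in X ->
  circuit (map (pr e) X).
Proof.
move=> eX e0 k1 kd; rewrite free_cons => /andP[eb fb] bX c0 PX.
have ib : indep b.
  move=> a Ha i; have /vector.freeP/(_ a) := fb; apply.
  by rewrite -[RHS]Ha; apply: eq_bigr => j _; rewrite nth_mktuple.
exists k, (fun i => pr e (b i)), c; split=> //.
- by rewrite k1 -ltnS -(dim_pr eX).
- move=> a Ha; apply: ib; have : pr e (\sum_i a i *: b i) == 0.
    by rewrite linear_sum -[X in _ == X]Ha; apply/eqP/eq_bigr => i _; rewrite linearZ.
  rewrite pr_eq0 => /vlineP[t Et]; rewrite Et.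
  have [->|t0] := eqVneq t 0; first by rewrite scale0r.
  case/negP: eb; rewrite -[e](scalerK t0) -Et memvZ //; apply: memv_suml => i _.
  by rewrite memvZ // memv_span //; apply/mapP; exists i; rewrite ?mem_enum.
- by move=> i; apply: map_f.
have := map_f (pr e) PX; rewrite linearD linearZ linear_sum /= pre scaler0 add0r.
by under eq_bigr do rewrite linearZ.
Qed.

(** The preimages of the two pieces contain [e], and their dimensions may add up to one more than
    [sep] allows; [glue] repairs this. *)
Lemma sep_pr X G (e : E) : smaller K N (\dim <<X>>%VS) -> syz X G -> ~ trivial X G ->
  e \in X -> e != 0 -> sep (map (pr e) X) -> sep X.
Proof.
move=> IH sG nt eX e0 [L [M [cX dLM dL dM]]].
rewrite -!(dim_pr eX e0) in dLM dL dM *.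
pose A := [seq x <- X | x \in (L + <[e]>)%VS].
pose B := [seq x <- X | x \in (M + <[e]>)%VS].
have dadd (U : {vspace E}) : (\dim (U + <[e]>) <= \dim U + 1)%N.
  by rewrite (leq_trans (dimv_add_leqif _ _)) // leq_add2l dim_vline leq_b1.
have /dimvS dA : (<<A>> <= L + <[e]>)%VS.
  by apply/span_subvP=> a; rewrite mem_filter => /andP[].
have /dimvS dB : (<<B>> <= M + <[e]>)%VS.
  by apply/span_subvP=> a; rewrite mem_filter => /andP[].
have dd := dim_pr eX e0; have dL1 := dadd L; have dM1 := dadd M.
have inU (U : {vspace E}) x : pr e x \in U -> x \in (U + <[e]>)%VS.
  by move=> xU; rewrite -[x](subrK (pr e x)) addrC memv_add // pr_sub.
have eU (U : {vspace E}) : e \in (U + <[e]>)%VS by apply/(subvP (addvSr _ _))/memv_line.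
apply: (@glue _ _ X G A B e) => //.
- by move=> x; rewrite mem_filter => /andP[].
- by move=> x; rewrite mem_filter => /andP[].
- move=> x xX; have [xL|xM] := cX _ (map_f (pr e) xX); [left|right].
    by rewrite mem_filter xX inU.
  by rewrite mem_filter xX inU.
- by rewrite mem_filter eX eU.
- by rewrite mem_filter eX eU.
- by dlia.
- by dlia.
- by dlia.
Qed.

(** A trivial projection from [e] is handled by [scroll_ext], a nontrivial one by induction. By the
    last hypothesis either the circuit survives the projection, or the image has dimension at most 2
    and every syzygy on it is trivial. *)
Lemma sep_step X G (e : E) k (b : 'I_k -> E) (c : 'I_k -> K) (x : K) :
    smaller K N (\dim <<X>>%VS) -> syz X G -> ~ trivial X G ->
    e \in X -> e != 0 -> (0 < k)%N ->
    free (e :: mktuple b) -> (forall i, b i \in X) -> (forall i, c i != 0) ->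
    x *: e + \sum_i c i *: b i \in X ->
    (if x == 0%R then 1 < k else k.+1 < \dim <<X>>%VS)%N ->
    (k.+1 < \dim <<X>>%VS)%N && (1 < k)%N || (\dim <<X>>%VS <= 3)%N ->
  sep X.
Proof.
move=> IH sG nt eX e0 k0 feb bX c0 PX hk hd.
have [t|nt'] := pselect (trivial (map (pr e) X) (prG G e)).
  have [h0 h0X H] := trivial_pr sG eX t.
  exact: (@scroll_ext X G e h0 k b c x).
have dd := dim_pr eX e0; have sG' := syz_pr sG eX.
case/orP: hd => [/andP[kd k1]|d3]; last first.
  by case: nt'; apply: trivial_dim2; rewrite // -ltnS -dd.
apply: (@sep_pr X G e) => //; apply: (IH _ (prG G e)) => //; first by rewrite dd.
exact: (@circuit_pr X e k b c x).
Qed.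

Lemma sep_ind d : smaller K N d.
Proof.
elim: d => [|d IH] X G //; rewrite ltnS leq_eqVlt => /predU1P[dX|]; last exact: IH.
rewrite -dX in IH => sG nt [k [b [c [/andP[k1 kd] ib bX c0 PX]]]].
have fb := indep_free ib.
(* A circuit with [k > 2] is projected from one of its own points and still has at least three
   elements. For [k = 2], three points of a projective line, the centre is a point of [X] off that
   line. *)
have [k2|k3] := leqP k 2; last first.
  case: k k1 kd b c ib bX c0 PX fb k3 => [//|k] k1 kd b c ib bX c0 PX fb k3.
  have feb : free (b ord0 :: mktuple (fun i => b (lift ord0 i))).
    by move: fb; rewrite /= enum_ordSl /= -map_comp.
  apply: (@sep_step X G (b ord0) k (fun i => b (lift ord0 i))
    (fun i => c (lift ord0 i)) (c ord0)) => //.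
  - by apply: (free_not0 feb); rewrite mem_head.
  - by move: PX; rewrite big_ord_recl.
  - by rewrite (negbTE (c0 ord0)).
  - by rewrite kd -ltnS k3.
have [e eX eb] : exists2 e, e \in X & e \notin <<mktuple b>>%VS.
  have [/allP H|/allPn//] := boolP (all (fun e => e \in <<mktuple b>>%VS) X).
  have /dimvS : (<<X>> <= <<mktuple b>>)%VS by apply/span_subvP.
  by rewrite (eqnP fb) size_tuple leqNgt kd.
apply: (@sep_step X G e k b c 0) => //.
- by apply: contraNneq eb => ->; apply: mem0v.
- by apply: leq_trans k1.
- by rewrite free_cons eb.
- by rewrite scale0r add0r.
- by rewrite eqxx.
by rewrite k1 andbT; move: k1 k2 kd; clear; dlia.
Qed.

End Main.

(** * The Koszul complex of a polynomial ring *)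

Section FirstDiv.
Variables (K : fieldType) (n : nat).
Local Notation R := {mpoly K[n]}.
Implicit Types (f g : R) (m : 'X_{1..n}) (i j k : 'I_n).

Definition low (a : nat) m := [forall k : 'I_n, (k < a)%N ==> (m k == 0%N)].

Lemma lowP a m : reflect (forall k, (k < a)%N -> m k = 0%N) (low a m).
Proof.
apply: (iffP forallP) => H k; first by move=> ka; apply/eqP/(implyP (H k)).
by apply/implyP => /H->.
Qed.

Lemma low_sub a j m : (a <= j)%N -> low a (m - U_(j))%MM = low a m.
Proof.
move=> aj; apply: eq_forallb => k; rewrite mnmBE mnm1E.
by case: ltnP => //= ka; case: (j =P k) => [jk|_]; [rewrite jk in aj; lia|by rewrite subn0].
Qed.

(* The terms of f whose first variable is 'X_i, divided by 'X_i. *)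
Definition fdiv i f : R :=
  \sum_(m : 'X_{1..n < msize f}) (if low i m then f@_(m + U_(i)) else 0) *: 'X_[m].

Lemma mcoeff_fdiv i f m : (fdiv i f)@_m = if low i m then f@_(m + U_(i)) else 0.
Proof.
have [mf|fm] := ltnP (mdeg m) (msize f).
  exact: (mcoeff_mpoly (fun m => if low i m then f@_(m + U_(i)) else 0)).
rewrite raddf_sum big1 => [|m' _]; last first.
  rewrite /= mcoeffZ mcoeffX; case: eqP => [Em|_]; last by rewrite mulr0.
  by have := bmdeg m'; rewrite Em ltnNge fm.
rewrite memN_msupp_eq0 ?if_same //; apply: msize_mdeg_ge.
by rewrite mdegD (leq_trans fm) // leq_addr.
Qed.

Lemma fdiv_is_linear i : linear (fdiv i).
Proof.
move=> a f g; apply/mpolyP => m; rewrite mcoeffD mcoeffZ !mcoeff_fdiv.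
by case: low; rewrite ?mcoeffD ?mcoeffZ // mulr0 addr0.
Qed.

HB.instance Definition _ i :=
  GRing.isLinear.Build K R R _ (fdiv i) (fdiv_is_linear i).

Lemma mcoeffXM j f m : ('X_j * f)@_m = if m j == 0%N then 0 else f@_(m - U_(j)).
Proof.
case: eqP => [mj|/eqP mj].
  apply: memN_msupp_eq0; rewrite mulrC.
  rewrite (perm_mem (msuppMX _ _)); apply/mapP => -[m' _ Em].
  by move: mj; rewrite Em mnmDE mnm1E eqxx.
by rewrite -{1}(submK (m := U_(j)%MM) (m' := m)) ?lep1mP // addmC mulrC mcoeffMX.
Qed.

Lemma fdivXM_gt i j f : (j < i)%N -> fdiv i ('X_j * f) = 0.
Proof.
move=> ji; apply/mpolyP => m; rewrite mcoeff_fdiv mcoeff0.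
case: lowP => // /(_ j ji) mj; rewrite mcoeffXM mnmDE mnm1E mj.
by case: (i =P j) ji => [->|//]; rewrite ltnn.
Qed.

Lemma fdivXM_lt i j f : (i < j)%N -> fdiv i ('X_j * f) = 'X_j * fdiv i f.
Proof.
move=> ij; have nij : i != j by apply: contraTneq ij => ->; rewrite ltnn.
apply/mpolyP => m; rewrite mcoeffXM !mcoeff_fdiv mcoeffXM.
rewrite mnmDE mnm1E (negbTE nij) addn0 low_sub ?(ltnW ij) //.
case: eqP => [_|/eqP mj]; first by rewrite if_same.
suff -> : (m + U_(i) - U_(j) = m - U_(j) + U_(i))%MM by [].
by rewrite [RHS]addmC addmBA ?lep1mP // addmC.
Qed.

(** A monomial involving a variable of index below [a] has exactly one first variable, so exactly
    one summand returns it. *)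
Lemma fdiv_decomp (a : nat) f m : (a <= n)%N ->
  (\sum_(j : 'I_n | (j < a)%N) 'X_j * fdiv j f)@_m = if low a m then 0 else f@_m.
Proof.
move=> an; have E j : ('X_j * fdiv j f)@_m =
    if (m j != 0%N) && low j m then f@_m else 0.
  rewrite mcoeffXM mcoeff_fdiv low_sub //; case: eqP => //= /eqP mj.
  by rewrite submK ?lep1mP.
rewrite raddf_sum /= (eq_bigr _ (fun j _ => E j)).
case: ifP => [/lowP lo|/negbT]; first by rewrite big1 // => j /lo ->.
rewrite negb_forall => /existsP[k0]; rewrite negb_imply => k0P.
case: (@arg_minnP _ k0 (fun k => (k < a)%N && (m k != 0%N)) val k0P) => k /andP[ka mk] kmin.
have lk : low k m.
  apply/lowP => l lk; apply/eqP/negPn/negP => ml.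
  have kl : (k <= l)%N by apply: kmin; rewrite ml (ltn_trans lk ka).
  by rewrite leqNgt lk in kl.
rewrite (bigD1 k) //= mk lk big1 ?addr0 // => j /andP[ja jk].
case: ifP => // /andP[mj /lowP lj]; case/negP: mk.
have kj : (k <= j)%N by apply: kmin; rewrite ja.
by apply/eqP/lj; rewrite ltn_neqAle kj eq_sym andbT.
Qed.

Lemma fdivXM_eq i f : fdiv i ('X_i * f) + \sum_(j : 'I_n | (j < i)%N) 'X_j * fdiv j f = f.
Proof.
apply/mpolyP => m; rewrite mcoeffD fdiv_decomp 1?ltnW // mcoeff_fdiv mcoeffXM.
rewrite mnmDE mnm1E eqxx addn1 /= addmK.
by case: ifP => _; rewrite ?addr0 ?add0r.
Qed.

Lemma fdiv_sum f : \sum_j 'X_j * fdiv j f = f - (f@_0)%:MP.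
Proof.
apply/mpolyP => m; rewrite mcoeffB mcoeffC.
rewrite (eq_bigl (fun j : 'I_n => (j < n)%N)) => [|j]; last by rewrite ltn_ord.
rewrite fdiv_decomp //; case: eqP => [->|m0].
  by rewrite mulr1 subrr; case: lowP => // H; case: H => k _; rewrite mnm0E.
rewrite mulr0 subr0; case: lowP => // H; case: m0; apply/mnmP => k.
by rewrite mnm0E H.
Qed.

Lemma fdiv_homog i f d : f \is d.+1.-homog -> fdiv i f \is d.-homog.
Proof.
move=> /dhomogP hf; apply/dhomogP => m; rewrite mcoeff_msupp mcoeff_fdiv.
case: ifP => _; last by rewrite eqxx.
by rewrite -mcoeff_msupp => /hf; rewrite [LHS]mdegD mdeg1 addn1 => -[].
Qed.

Lemma fdiv_homog0 i f : f \is 0.-homog -> fdiv i f = 0.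
Proof.
move=> /dhomog_nemf_coeff hf; apply/mpolyP => m.
by rewrite mcoeff_fdiv mcoeff0; case: ifP => // _; apply: hf; rewrite [X in X != _]mdegD mdeg1 addn1.
Qed.

End FirstDiv.

Section Koszul.
Variables (K : fieldType) (n : nat).
Local Notation R := {mpoly K[n]}.
Implicit Types (f g : R) (i j k : 'I_n) (T S : {set 'I_n}).

Definition ksgn j T : R := (-1) ^+ #|[set k in T | (k < j)%N]|.

Lemma ksgn_lt j i T : (j < i)%N -> ksgn j (T :\ i) = ksgn j T.
Proof.
move=> ji; congr (_ ^+ _); apply: eq_card => k; rewrite !inE.
by case: (k =P i) => //= ->; rewrite [(_ < _)%N]ltnNge (ltnW ji) andbF.
Qed.

Lemma ksgn_gt j i T : i \in T -> (i < j)%N -> ksgn j (T :\ i) = - ksgn j T.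
Proof.
move=> iT ij; rewrite /ksgn [in RHS](cardsD1 i) !inE iT ij exprS mulN1r opprK.
by congr (_ ^+ _); apply: eq_card => k; rewrite !inE andbA.
Qed.

Lemma ksgn_add j i T : i \notin T -> (i < j)%N -> ksgn j (i |: T) = - ksgn j T.
Proof.
move=> iT ij; rewrite -{2}(setU1K iT) ksgn_gt ?opprK //.
by rewrite setU11.
Qed.

Lemma ksgn_full j T : (forall k, (k < j)%N -> k \in T) -> ksgn j T = (-1) ^+ j.
Proof.
move=> H; congr (_ ^+ _).
rewrite (eq_card (B := [pred k : 'I_n | (k < j)%N])) => [|k]; last first.
  by rewrite !inE; apply: andb_idl => /H.
have jn := ltnW (ltn_ord j).
rewrite -[RHS]card_ord -(card_image (f := widen_ord jn)) => [|k l /(congr1 val) kl]; last exact: val_inj.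
apply: eq_card => k; rewrite !inE; apply/idP/imageP => [kj|[l _ ->]]; last exact: ltn_ord l.
by exists (Ordinal kj) => //; apply: val_inj.
Qed.


(** A family [c] stands for the sum of the [c T e_T] in the exterior algebra over [R], and [kos]
    multiplies it by the sum of the ['X_j e_j]. In this self-dual form of the Koszul complex, sets
    of size [s] sit in homological degree [n - s]. *)
Definition kos (c : {set 'I_n} -> R) T : R :=
  \sum_(j in T) ksgn j T * ('X_j * c (T :\ j)).

(** The terms for [(j, k)] and [(k, j)] cancel: deleting the smaller index flips the sign of the
    larger. *)
Lemma kos_kos c T : kos (kos c) T = 0.
Proof.
pose F j k := ksgn j T * ksgn k (T :\ j) * ('X_j * 'X_k * c (T :\ j :\ k)).
have -> : kos (kos c) T = \sum_(j in T) \sum_(k in T | k != j) F j k.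
  apply: eq_bigr => j jT; rewrite !mulr_sumr; apply: eq_big => k.
    by rewrite !inE andbC.
  by move=> _; rewrite /F; ring.
have -> : \sum_(j in T) \sum_(k in T | k != j) F j k =
    \sum_(j in T) \sum_(k in T | (k < j)%N) (F j k + F k j).
  under [RHS]eq_bigr do rewrite big_split /=.
  rewrite big_split /= [X in _ = _ + X](exchange_big_dep (fun k => k \in T)) /=; last first.
    by move=> j k _ /andP[].
  rewrite -big_split; apply: eq_bigr => j jT /=.
  rewrite (bigID (fun k : 'I_n => (k < j)%N)) /=; congr (_ + _); apply: eq_bigl => k.
    by rewrite -andbA -(inj_eq val_inj); congr (_ && _); case: ltngtP.
  by rewrite jT -andbA -(inj_eq val_inj); congr (_ && _); case: ltngtP.
apply: big1 => j jT; apply: big1 => k /andP[kT kj].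
rewrite /F ksgn_lt // ksgn_gt // setDDl setDDl [[set k] :|: _]setUC.
by ring.
Qed.

Definition first_out T := [pick i | (i \notin T) && [forall k : 'I_n, (k < i)%N ==> (k \in T)]].

Lemma first_outP i T : i \notin T -> (forall k : 'I_n, (k < i)%N -> k \in T) ->
  first_out T = Some i.
Proof.
move=> iT iP; rewrite /first_out; case: pickP => [j /andP[jT /forallP jP]|/(_ i)].
  congr Some; apply: val_inj; apply/eqP.
  rewrite eqn_leq leqNgt [X in _ && X]leqNgt; apply/andP; split.
    by apply: contra iT => ij; exact: (implyP (jP i)).
  by apply: contra jT => ji; exact: iP.
by rewrite iT /= => /negP[]; apply/forallP => k; apply/implyP/iP.
Qed.

Lemma first_out_full : first_out [set: 'I_n] = None.
Proof. by rewrite /first_out; case: pickP => // i; rewrite inE. Qed.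

Lemma first_out_ex T : T != [set: 'I_n] ->
  exists2 i, i \notin T & forall k : 'I_n, (k < i)%N -> k \in T.
Proof.
rewrite -subTset => /subsetPn[i0 _ i0T].
case: (@arg_minnP _ i0 (fun k => k \notin T) val i0T) => i iT imin.
exists i => // k ki; apply/negPn/negP => /imin ik.
by have := leq_trans ki ik; rewrite ltnn.
Qed.

(* A contracting homotopy of the Koszul complex: its monomial basis is matched
   along the first variable occurring in a monomial or missing from T. *)
Definition htp (c : {set 'I_n} -> R) T : R :=
  if first_out T is Some i then (-1) ^+ i * fdiv i (c (i |: T)) else 0.

Lemma fdiv_sgn i b f : fdiv i ((-1) ^+ b * f) = (-1) ^+ b * fdiv i f.
Proof. by rewrite -signr_odd; case: odd; rewrite ?mulN1r ?mul1r ?linearN. Qed.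

Lemma htp_full c : htp c [set: 'I_n] = 0.
Proof. by rewrite /htp first_out_full. Qed.

(** At the full set the homology is the residue field [K], so exactly the constant term is lost. *)
Lemma kos_htp_full c :
  kos (htp c) [set: 'I_n] = c [set: 'I_n] - ((c [set: 'I_n])@_0)%:MP.
Proof.
rewrite -fdiv_sum; apply: eq_big => [j|j _]; first by rewrite inE.
rewrite ksgn_full => [|k _]; last by rewrite inE.
rewrite /htp (@first_outP j) ?setD11 // => [|k kj]; last first.
  by rewrite !inE andbT; apply: contraTneq kj => ->; rewrite ltnn.
rewrite setD1K // mulrCA; congr (_ * _).
by rewrite mulrA -exprD addnn -mul2n exprM sqrrN !expr1n mul1r.
Qed.

(** Let [i] be the first index outside [T]. The summands [j < i] of [kos (htp c)] and the summand
    [i] of [htp (kos c)] rebuild [c T] by [fdivXM_eq]; the remaining ones vanish or cancel. *)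
Lemma kos_htp c T : T != [set: 'I_n] -> kos (htp c) T + htp (kos c) T = c T.
Proof.
move=> /first_out_ex[i iT iP].
have htpE c' : htp c' T = (-1) ^+ i * fdiv i (c' (i |: T)) by rewrite /htp (first_outP iT iP).
have sq (a : nat) : (-1) ^+ a * (-1) ^+ a = 1 :> R.
  by rewrite -exprD addnn -mul2n exprM sqrrN !expr1n.
have nTi j : j \in T -> j != i by apply: contraTneq => ->.
rewrite htpE /kos (bigID (fun j : 'I_n => (j < i)%N)) /=.
(* Removing [j < i] from [T] makes [j] the first index outside, so [htp] divides by ['X_j] and the
   two signs cancel. *)
rewrite [X in X + _ + _](_ : _ = \sum_(j : 'I_n | (j < i)%N) 'X_j * fdiv j (c T)); last first.
  apply: eq_big => [j|j /andP[jT ji]]; first by apply: andb_idl => /iP.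
  have jP (k : 'I_n) : (k < j)%N -> k \in T by move=> kj; apply/iP/(ltn_trans kj).
  rewrite ksgn_full // /htp (@first_outP j) ?setD11 // => [|k kj]; last first.
    by rewrite !inE (jP k kj) andbT; apply: contraTneq kj => ->; rewrite ltnn.
  by rewrite setD1K // mulrCA; congr (_ * _); rewrite mulrA sq mul1r.
rewrite big_setU1 //= setU1K // linearD /= mulrDr ksgn_full; last first.
  by move=> k ki; rewrite inE iP ?orbT.
rewrite fdiv_sgn mulrA sq mul1r linear_sum /=.
rewrite [X in _ + (_ + _ * X)](bigID (fun j : 'I_n => (j < i)%N)) /=.
rewrite [X in _ + (_ + _ * (X + _))]big1 => [|j /andP[jT ji]]; last first.
  by rewrite /ksgn fdiv_sgn fdivXM_gt // mulr0.
rewrite add0r mulr_sumr addrACA [X in X + _]addrC fdivXM_eq -big_split /=.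
(* For [j > i] both composites divide by ['X_i] and multiply by ['X_j], with opposite signs. *)
rewrite big1 ?addr0 // => j /andP[jT]; rewrite -leqNgt => ij.
have lij : (i < j)%N by rewrite ltn_neqAle ij andbT eq_sym nTi.
have iTj : i \notin T :\ j by rewrite !inE negb_and iT orbT.
rewrite {1}/htp (@first_outP i) // => [|k ki]; last first.
  by rewrite !inE iP // andbT; apply: contraTneq ki => ->; rewrite -leqNgt.
have -> : (i |: T) :\ j = i |: (T :\ j).
  rewrite setDUl; congr (_ :|: _); apply/setP => k; rewrite !inE.
  by apply: andb_idl => /eqP->; rewrite eq_sym nTi.
have fsgn (b : nat) g : fdiv i ((- (-1) ^+ b) * g) = - ((-1) ^+ b * fdiv i g).
  by rewrite mulNr linearN /= fdiv_sgn.
rewrite ksgn_add // /ksgn fsgn fdivXM_lt //.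
by ring.
Qed.

End Koszul.

(** * From a free resolution to the Koszul complex *)

Section Zigzag.
Variables (K : fieldType) (m : nat).
Local Notation R := {mpoly K[m]}.
Implicit Types (f g : R) (j : 'I_m) (T S : {set 'I_m}).

Definition kosv r (c : {set 'I_m} -> 'rV[R]_r) T : 'rV[R]_r :=
  \sum_(j in T) (ksgn K j T * 'X_j) *: c (T :\ j).

Definition htpv r (c : {set 'I_m} -> 'rV[R]_r) T : 'rV[R]_r :=
  \row_t htp (fun S => c S 0 t) T.

Lemma kosvE r (c : {set 'I_m} -> 'rV[R]_r) T t :
  kosv c T 0 t = kos (fun S => c S 0 t) T.
Proof. by rewrite summxE; apply: eq_bigr => j _; rewrite mxE mulrA. Qed.

Lemma kosv_mul r s (c : {set 'I_m} -> 'rV[R]_r) (M : 'M_(r, s)) T :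
  kosv (fun S => c S *m M) T = kosv c T *m M.
Proof. by rewrite mulmx_suml; apply: eq_bigr => j _; rewrite scalemxAl. Qed.

Lemma kosvD r (b c : {set 'I_m} -> 'rV[R]_r) T :
  kosv (fun S => b S + c S) T = kosv b T + kosv c T.
Proof. by rewrite -big_split; apply: eq_bigr => j _; rewrite scalerDr. Qed.

Lemma eq_kosv r (b c : {set 'I_m} -> 'rV[R]_r) T : b =1 c -> kosv b T = kosv c T.
Proof. by move=> bc; apply: eq_bigr => j _; rewrite bc. Qed.

Lemma kosv_kosv r (c : {set 'I_m} -> 'rV[R]_r) T : kosv (kosv c) T = 0.
Proof.
apply/rowP => t; rewrite kosvE mxE -[RHS](kos_kos (fun S => c S 0 t) T).
by apply: eq_bigr => j _; rewrite kosvE.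
Qed.

Lemma mcoeff0XM j f : ('X_j * f)@_0 = 0.
Proof. by rewrite mcoeffXM mnm0E. Qed.

Variables (I : R -> Prop) (F : graded_free_resolution I).

(** Total degree [D] in the twisted free module. Subtraction is truncated, so entries with
    [shift t > D] are required to vanish separately. *)
Definition homv i D (u : 'rV[R]_(rk F i)) :=
  forall t, if (shift t <= D)%N then u 0 t \is (D - shift t).-homog else u 0 t == 0.

Lemma homv_mul i k D u (M : 'M[R]_(rk F i, rk F k)) :
  homog_mx (@shift _ _ _ F i) (@shift _ _ _ F k) M -> homv D u -> homv D (u *m M).
Proof.
move=> hM hu t; have E p : if (shift t <= D)%N then u 0 p * M p t \is (D - shift t).-homog
    else u 0 p * M p t == 0.
  case: (hM p t) => [->|[d dp hMp]]; first by rewrite mulr0 rpred0 eqxx if_same.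
  move: (hu p); case: leqP => [pD up|_ /eqP->]; last by rewrite mul0r rpred0 eqxx if_same.
  rewrite (leq_trans _ pD) ?dp ?leq_addr //.
  have -> : (D - shift t = (D - shift p) + d)%N by move: pD; rewrite dp; clear; lia.
  exact: dhomogM.
rewrite mxE; case: leqP E => _ E; first by apply: rpred_sum => p _; apply: E.
by rewrite big1 // => p _; apply/eqP/E.
Qed.

Lemma homv_htp i D (c : {set 'I_m} -> 'rV[R]_(rk F i)) T :
  (forall S, homv D.+1 (c S)) -> homv D (htpv c T).
Proof.
move=> hc t; rewrite mxE /htp; case: first_out => [j|]; last by rewrite rpred0 eqxx if_same.
move: (hc (j |: T) t); set f := c _ 0 t.
have sg d (h : R) : h \is d.-homog -> (-1) ^+ j * h \is d.-homog.
  by rewrite -signr_odd; case: odd; rewrite ?mulN1r ?rpredN ?mul1r.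
case: (leqP (shift t) D) => [tD|Dt].
  by rewrite leqW // subSn // => /fdiv_homog H; apply/sg/H.
case: leqP => [tD|_ /eqP->]; last by rewrite linear0 mulr0.
have -> : (D.+1 - shift t = 0)%N by apply/eqP; rewrite subn_eq0.
by move/fdiv_homog0 => ->; rewrite mulr0.
Qed.

Lemma htpv_supp r (c : {set 'I_m} -> 'rV[R]_r) s :
  (forall T, #|T| != s.+1 -> c T = 0) -> forall T, #|T| != s -> htpv c T = 0.
Proof.
move=> hc T hT; apply/rowP => t; rewrite !mxE /htp /first_out.
case: pickP => // j /andP[jT _]; rewrite hc ?mxE ?linear0 ?mulr0 //.
by rewrite cardsU1 jT.
Qed.

(** The sum of the images of the two differentials of the double complex at [F_i]. *)
Definition bnd i (c : {set 'I_m} -> 'rV[R]_(rk F i)) := exists b b',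
  forall T, c T = kosv b T + b' T *m diff F i.

Lemma diff_diff i (u : 'rV[R]_(rk F i.+2)) : u *m diff F i.+1 *m diff F i = 0.
Proof. by apply/diff_exact; exists u. Qed.

(** The image of [c] under [diff F i] is a Koszul cycle without constant term at the full set, so
    the homotopy yields a Koszul preimage [c']. If [c'] is [kosv b] plus the image of [b'], then
    [diff F i] kills [c - kosv b'], and exactness of [F] concludes. *)
Lemma zigzag_step i (c : {set 'I_m} -> 'rV[R]_(rk F i.+1)) D s :
    (forall T, homv D.+1 (c T)) -> (forall T, #|T| != s.+1 -> c T = 0) ->
    (forall T, kosv c T *m diff F i = 0) ->
    (forall t, ((c [set: 'I_m] *m diff F i) 0 t)@_0 = 0) ->
  exists c' : {set 'I_m} -> 'rV[R]_(rk F i),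
    [/\ forall T, homv D (c' T), forall T, #|T| != s -> c' T = 0,
        forall T, kosv c' T = c T *m diff F i, c' [set: 'I_m] = 0 & bnd c' -> bnd c].
Proof.
move=> hc sc kc c0; pose dc T := c T *m diff F i.
have kc' T : kosv (htpv dc) T = dc T.
  apply/rowP => t; rewrite kosvE.
  have -> : kos (fun S => htpv dc S 0 t) T = kos (htp (fun S => dc S 0 t)) T.
    by apply: eq_bigr => j _; rewrite mxE.
  have [->|nT] := eqVneq T [set: 'I_m]; first by rewrite kos_htp_full c0 mpolyC0 subr0.
  rewrite -[RHS](kos_htp (fun S => dc S 0 t) nT) -[LHS]addr0; congr (_ + _).
  rewrite /htp; case: first_out => // j.
  by rewrite -kosvE /dc kosv_mul kc mxE linear0 mulr0.
exists (htpv dc); split=> //.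
- by move=> T; apply: homv_htp => S; apply: homv_mul (hc S); exact: diff_homog.
- by apply: htpv_supp => T /sc; rewrite /dc => ->; rewrite mul0mx.
- by apply/rowP => t; rewrite !mxE htp_full.
case=> b [b' bE]; have : forall T, exists v, c T - kosv b' T = v *m diff F i.+1.
  move=> T; apply/diff_exact; rewrite mulmxBl -/(dc T) -kc' (eq_kosv _ bE).
  by rewrite kosvD kosv_kosv add0r kosv_mul subrr.
case/fin_all_exists=> v vE; exists b', v => T.
by rewrite -vE addrC subrK.
Qed.

(** Each step lowers the degree and the size of the index sets by one. The new family vanishes at
    the full set, so the condition on constant terms persists. *)
Lemma zigzag i (c : {set 'I_m} -> 'rV[R]_(rk F i.+1)) D s :
    (forall T, homv (D + i.+1) (c T)) -> (forall T, #|T| != (s + i.+1)%N -> c T = 0) ->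
    (forall T, kosv c T *m diff F i = 0) ->
    (forall t, ((c [set: 'I_m] *m diff F i) 0 t)@_0 = 0) ->
  exists c' : {set 'I_m} -> 'rV[R]_(rk F 0),
    [/\ forall T, homv D (c' T), forall T, #|T| != s -> c' T = 0,
        forall T, exists v, kosv c' T = v *m diff F 0 & bnd c' -> bnd c].
Proof.
elim: i c => [|i IH] c; rewrite ![(_ + _.+1)%N]addnS => hc sc kc c0.
  have [c' []] := zigzag_step hc sc kc c0; rewrite !addn0 => h1 h2 h3 _ h4.
  by exists c'; split=> // T; exists (c T).
have [c' [h1 h2 h3 h4 h5]] := zigzag_step hc sc kc c0.
have [T|T|T|t|c'' [g1 g2 g3 g4]] := IH c'.
- by rewrite addnS.
- by rewrite addnS; apply: h2.
- by rewrite h3 diff_diff.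
- by rewrite h4 mul0mx mxE mcoeff0.
by exists c''; split=> // /g4/h5.
Qed.

Definition ideal (J : R -> Prop) :=
  [/\ J 0, forall f g, J f -> J g -> J (f + g) & forall f g, J g -> J (f * g)].

Lemma ideal_kos J (c : {set 'I_m} -> R) T : ideal J -> (forall S, J (c S)) -> J (kos c T).
Proof.
move=> [J0 JD JM] Jc; apply: (big_ind J J0 JD) => j _.
exact/JM/JM.
Qed.

Lemma const_mulmx i (u : 'rV[R]_(rk F i.+1)) :
  map_mx (mcoeff 0%MM) (u *m diff F i) = map_mx (mcoeff 0%MM) u *m diff_tensor F i.
Proof.
apply/rowP => t; rewrite !mxE raddf_sum; apply: eq_bigr => p _.
by rewrite !mxE /= mcoeff0_is_multiplicative.
Qed.

(** A cycle [z] that is not a boundary is placed at the full index set as constants and carried down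
    to [F_0], and the augmentation turns the result into [g]. If [g] came from constants, the way
    back would make [z] a boundary. *)
Lemma koszul_class p : ideal I -> homology_dim F p.+1 p.+2 <> 0%N -> (p.+1 <= m)%N ->
  exists g : {set 'I_m} -> R,
    [/\ forall T, g T \is 1.-homog, forall T, #|T| != (m - p.+1)%N -> g T = 0,
        forall T, I (kos g T) &
        ~ exists y : {set 'I_m} -> K, forall T, g T = kos (fun S => (y S)%:MP) T].
Proof.
move=> idI hn0 pm.
set dg := degree_part F p.+1 p.+2; set B := degree_part F p.+2 p.+2 *m diff_tensor F p.+1.
have /row_subPn[a0 zB] : ~~ (dg :&: cycles F p.+1 <= B)%MS.
  by apply/negP => /mxrankS le; apply: hn0; apply/eqP; rewrite subn_eq0.
have := row_sub a0 (dg :&: cycles F p.+1)%MS; set z := row a0 _ in zB *.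
rewrite sub_capmx => /andP[zdg /sub_kermxP zc].
have zsh t : z 0 t != 0 -> shift t = p.+2.
  case/submxP: zdg => w ->; rewrite mul_mx_diag !mxE; case: (shift t =P p.+2) => // _.
  by rewrite mulr0 eqxx.
pose c T : 'rV[R]_(rk F p.+1) := if T == [set: 'I_m] then map_mx (@mpolyC m K) z else 0.
have cfull : c [set: 'I_m] = map_mx (@mpolyC m K) z by rewrite /c eqxx.
have constz : map_mx (mcoeff 0%MM) (map_mx (@mpolyC m K) z) = z.
  by apply/rowP => t; rewrite !mxE mcoeffC eqxx mulr1.
have hc T : homv (1 + p.+1) (c T).
  move=> t; rewrite /c; case: eqP => _; last by rewrite mxE rpred0 eqxx if_same.
  rewrite mxE; have [->|zt] := eqVneq (z 0 t) 0; first by rewrite mpolyC0 rpred0 eqxx if_same.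
  by rewrite (zsh t zt) leqnn subnn; apply/dhomogP => k; rewrite msuppC (negbTE zt) inE => /eqP->; apply: mdeg0.
have sc T : #|T| != (m - p.+1 + p.+1)%N -> c T = 0.
  by rewrite subnK // /c; case: (T =P _) => // ->; rewrite cardsT card_ord eqxx.
have kc T : kosv c T *m diff F p = 0.
  rewrite /kosv big1 ?mul0mx // => j jT; rewrite /c; case: eqP => [E|_]; last by rewrite scaler0.
  by have := in_setT j; rewrite -E setD11.
have c0 t : ((c [set: 'I_m] *m diff F p) 0 t)@_0 = 0.
  have /rowP/(_ t) := const_mulmx (c [set: 'I_m]).
  by rewrite cfull constz zc !mxE.
have [c' [h1 h2 h3 h4]] := zigzag hc sc kc c0.
pose g T := (c' T *m aug F) 0 0; exists g; split.
- move=> T; rewrite /g mxE; apply: rpred_sum => q _.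
  case: (@aug_homog _ _ _ F q 0) => [->|[d]]; first by rewrite mulr0 rpred0.
  rewrite add0n => dq hd; move: (h1 T q); case: leqP => [q1 hq|_ /eqP->]; last by rewrite mul0r rpred0.
  by have := dhomogM hq hd; rewrite -dq subnK.
- by move=> T /h2; rewrite /g => ->; rewrite mul0mx mxE.
- move=> T; have [v vE] := h3 T.
  have : I ((kosv c' T *m aug F) 0 0) by apply/aug_exact; exists v.
  by rewrite -kosv_mul kosvE.
case=> y gy; have [e eE] : exists e : {set 'I_m} -> 'rV[R]_(rk F 0), forall S,
    I ((e S *m aug F) 0 0 - (y S)%:MP).
  have H S : exists u, I ((u *m aug F) 0 0 - (y S)%:MP) := aug_surj F (y S)%:MP.
  by case: (fin_all_exists H) => e; exists e.
(* With the constants lifted to [e] in [F_0], the difference [c' - kosv e] is sent into [I], hence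
   comes from [F_1]. *)
have /h4[b [b' bE]] : bnd c'.
  have : forall T, exists v, c' T - kosv e T = v *m diff F 0.
    move=> T; apply/aug_exact.
    have -> : ((c' T - kosv e T) *m aug F) 0 0 =
        -1 * kos (fun S => (e S *m aug F) 0 0 - (y S)%:MP) T.
      rewrite mulmxBl mxE -/(g T) gy mxE -kosv_mul kosvE mulN1r -sumrB -sumrN.
      by apply: eq_bigr => j _; ring.
    by have [J0 JD JM] := idI; apply: JM; apply: ideal_kos.
  by case/fin_all_exists=> v vE; exists e, v => T; rewrite -vE addrC subrK.
(* Constant terms kill the Koszul part, whose summands are multiples of variables. *)
have zE : z = map_mx (mcoeff 0%MM) (b' [set: 'I_m]) *m diff_tensor F p.+1.
  rewrite -const_mulmx -constz -cfull bE; apply/rowP => t; rewrite !mxE mcoeffD.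
  rewrite [X in X + _](_ : _ = 0) ?add0r ?mxE // kosvE raddf_sum big1 // => j _ /=.
  by rewrite mcoeff0_is_multiplicative mcoeff0XM mulr0.
case/negP: zB; apply/submxP; exists (map_mx (mcoeff 0%MM) (b' [set: 'I_m])).
rewrite /B mulmxA mul_mx_diag; apply/rowP => t.
(* Constant entries of the differential join only generators of equal degree, so the part of degree
   [p.+2] already maps onto [z]. *)
have dtsh q : diff_tensor F p.+1 q t != 0 -> shift q = shift t.
  rewrite mxE; case: (@diff_homog _ _ _ F p.+1 q t) => [->|[d -> hd]]; first by rewrite mcoeff0 eqxx.
  case: d hd => [|d] hd; first by rewrite addn0.
  by rewrite (dhomog_nemf_coeff hd) ?eqxx //= mdeg0.
move: (diff_tensor F p.+1) zE dtsh => dt zE dtsh.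
rewrite [RHS]mxE; have [tp|tp] := eqVneq (shift t) p.+2.
  rewrite {1}zE mxE; apply: eq_bigr => q _; rewrite !mxE.
  have [->|/dtsh->] := eqVneq (dt q t) 0; first by rewrite !mulr0.
  by rewrite tp eqxx mulr1.
have -> : z 0 t = 0 by apply/eqP; apply: contraNT tp => /zsh ->.
rewrite big1 // => q _; have [->|/dtsh qt] := eqVneq (dt q t) 0.
  by rewrite mulr0.
by rewrite !mxE qt (negbTE tp) mulr0 mul0r.
Qed.

End Zigzag.

(** * From Koszul classes to syzygies of points *)

Section LinearForms.
Variables (K : fieldType) (m : nat).
Local Notation R := {mpoly K[m]}.

(** Linear in [w] for every [f], unlike evaluation of [f], with which it agrees on linear forms. *)
Definition lin_eval (f : R) (w : 'rV[K]_m) : K := \sum_j f@_U_(j) * w 0 j.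

Lemma lin_eval_is_linear f : scalar (lin_eval f).
Proof.
move=> a u v; rewrite /lin_eval mulr_sumr -big_split; apply: eq_bigr => j _.
by rewrite /= !mxE; ring.
Qed.

Lemma linear_formE (f : R) : f \is 1.-homog -> f = \sum_j f@_U_(j) *: 'X_j.
Proof.
move=> hf; apply/mpolyP => k; rewrite raddf_sum /=.
have [/mdeg1P[i /eqP->]|k1] := boolP (mdeg k == 1%N).
  rewrite (bigD1 i) //= mcoeffZ mcoeffXU eqxx mulr1 big1 ?addr0 // => j ji.
  by rewrite mcoeffZ mcoeffXU (negbTE ji) mulr0.
rewrite (dhomog_nemf_coeff hf k1) big1 // => j _; rewrite mcoeffZ mcoeffX.
by case: (U_(j)%MM =P k) k1 => [<-|_]; rewrite ?mdeg1 // mulr0.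
Qed.

Lemma lin_evalE (f : R) (w : 'rV[K]_m) : f \is 1.-homog -> f.@[w 0] = lin_eval f w.
Proof.
move=> hf; rewrite {1}(linear_formE hf) raddf_sum; apply: eq_bigr => j _.
by rewrite /= mevalZ mevalXU.
Qed.

Lemma kos_set2 (c : {set 'I_m} -> R) (a b : 'I_m) : (a < b)%N ->
  kos c [set a; b] = 'X_a * c [set b] - 'X_b * c [set a].
Proof.
move=> ab; have nab : a != b by rewrite -(inj_eq val_inj) neq_ltn ab.
rewrite /kos big_setU1 ?inE //= big_set1.
have -> : [set a; b] :\ a = [set b] by rewrite setU1K ?inE.
have -> : [set a; b] :\ b = [set a] by rewrite setUC setU1K ?inE // eq_sym.
have -> : ksgn K a [set a; b] = 1.
  rewrite /ksgn (_ : [set k in _ | _] = finset.set0) ?cards0 //.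
  by apply/setP => k; rewrite !inE; apply/negbTE; case: eqP => [->|_]; case: eqP => [->|_] //=; rewrite ?ltnn // ltnNge ltnW.
have -> : ksgn K b [set a; b] = -1.
  rewrite /ksgn (_ : [set k in _ | _] = [set a]) ?cards1 //.
  apply/setP => k; rewrite !inE; case: eqP => [->|_] /=; first by rewrite ab.
  by case: eqP => [->|//]; rewrite ltnn.
by rewrite mul1r mulN1r.
Qed.

Lemma kos_set3 (g : {set 'I_m} -> R) (a b c : 'I_m) : (a < b)%N -> (b < c)%N ->
  kos g [set a; b; c] = 'X_a * g [set b; c] - 'X_b * g [set a; c] + 'X_c * g [set a; b].
Proof.
move=> ab bc; have ac := ltn_trans ab bc.
have nab : a != b by rewrite -(inj_eq val_inj) neq_ltn ab.
have nac : a != c by rewrite -(inj_eq val_inj) neq_ltn ac.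
have nbc : b != c by rewrite -(inj_eq val_inj) neq_ltn bc.
rewrite /kos -setUA big_setU1 ?inE ?negb_or ?nab //= big_setU1 ?inE //= big_set1.
have -> : (a |: [set b; c]) :\ a = [set b; c] by rewrite setU1K // !inE negb_or nab.
have -> : (a |: [set b; c]) :\ b = [set a; c].
  by rewrite setUCA setU1K // !inE negb_or eq_sym nab.
have -> : (a |: [set b; c]) :\ c = [set a; b].
  by rewrite setUA setUC setU1K // !inE negb_or eq_sym nac eq_sym.
have lt_b (k : 'I_m) : k \in [set a; b; c] -> (k < b)%N = (k == a).
  rewrite !inE -!(inj_eq val_inj) /= -orbA => /or3P[]/eqP->; first by rewrite ab eqxx.
    by rewrite ltnn; apply/esym/negbTE; rewrite neq_ltn ab orbT.
  by rewrite ltnNge ltnW //=; apply/esym/negbTE; rewrite neq_ltn ac orbT.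
have -> : ksgn K a (a |: [set b; c]) = 1.
  rewrite /ksgn (_ : [set k in _ | _] = finset.set0) ?cards0 //.
  apply/setP => k; rewrite !inE; apply/negbTE/negP => /andP[/or3P[]/eqP->].
  - by rewrite ltnn.
  - by rewrite ltnNge ltnW.
  - by rewrite ltnNge ltnW.
have -> : ksgn K b (a |: [set b; c]) = -1.
  rewrite /ksgn (_ : [set k in _ | _] = [set a]) ?cards1 //.
  apply/setP => k; rewrite setUA inE [RHS]inE; apply/andP/eqP => [[/lt_b-> /eqP]//|->].
  by rewrite !inE eqxx ab.
have -> : ksgn K c (a |: [set b; c]) = 1.
  rewrite /ksgn (_ : [set k in _ | _] = [set a; b]) ?cards2 ?nab ?expr2 ?mulrNN ?mulr1 //.
  apply/setP => k; rewrite !inE orbA; apply/andP/orP => [[/orP[/orP//|/eqP->]]|[]/eqP->].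
  - by rewrite ltnn.
  - by rewrite eqxx.
  - by rewrite eqxx orbT.
by ring.
Qed.

End LinearForms.

Lemma vanishing_ideal_ideal (K : fieldType) (n : nat) (X : {fset pspace K n}) :
  ideal (vanishing_ideal X).
Proof.
split=> [d P v _ _|f g If Ig d P v PX vP|f g Ig d P v PX vP].
- by rewrite pihomog0 meval0.
- by rewrite pihomogD mevalD (If d P) // (Ig d P) // addr0.
pose ev := (meval (v 0) \o pihomog mdeg d).
have evD : {morph ev : p q / p + q} by move=> p q; rewrite /ev /= pihomogD mevalD.
have ev0 : ev 0 = 0 by rewrite /ev /= pihomog0 meval0.
change (ev (f * g) = 0).
(* After both factors are split into homogeneous components, each product of degree [d] contains a
   component of [g], which vanishes at [v]. *)
rewrite (pihomog_partitionE (mf := mdeg) (leqnn (msize f))).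
rewrite (pihomog_partitionE (mf := mdeg) (leqnn (msize g))) mulr_suml.
rewrite (big_morph ev evD ev0) big1 // => a _.
rewrite mulr_sumr (big_morph ev evD ev0) big1 // => b _; rewrite /ev /=.
have hab := dhomogM (pihomogP mdeg a f) (pihomogP mdeg b g).
have [<-|nd] := eqVneq (a + b)%N d; last by rewrite (pihomog_ne0 nd hab) meval0.
by rewrite pihomog_dE // mevalM (Ig b P) // mulr0.
Qed.

Lemma wedgeE (K : fieldType) (m : nat) (v w : 'rV[K]_m) b c :
  wedge v w b c = v 0 b * w 0 c - w 0 b * v 0 c.
Proof. by rewrite !mxE !big_ord1 !mxE. Qed.

Section KoszulSyzygy.
Variables (K : fieldType) (m : nat).
Local Notation R := {mpoly K[m]}.
Variable g : {set 'I_m} -> R.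

(** The bivector [G w]: the entries of [g] on pairs, evaluated at [w]. *)
Definition syz_mx (w : 'rV[K]_m) : 'M[K]_m := \matrix_(a, b)
  (if (a < b)%N then lin_eval (g [set a; b]) w
   else if (b < a)%N then - lin_eval (g [set b; a]) w else 0).

Lemma syz_mx_is_linear : linear syz_mx.
Proof.
move=> k u v; apply/matrixP => a b; rewrite !mxE.
case: ltngtP => _; rewrite ?lin_eval_is_linear ?mulr0 ?addr0 //.
by rewrite opprD mulrN.
Qed.

HB.instance Definition _ :=
  GRing.isLinear.Build K 'rV[K]_m 'M[K]_m _ syz_mx syz_mx_is_linear.

Hypothesis g1 : forall T, g T \is 1.-homog.

Lemma kos_homog T : kos g T \is 2.-homog.
Proof.
apply: rpred_sum => j _.
have hX : ('X_j : R) \is 1.-homog by rewrite dhomogX /= mdeg1.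
have h := dhomogM hX (g1 (T :\ j)).
by rewrite /ksgn -signr_odd; case: odd; rewrite ?mulN1r ?rpredN ?mul1r.
Qed.

Lemma syz_mx_C w a b : syz_mx w a b = - syz_mx w b a.
Proof. by rewrite !mxE; case: ltngtP => // _; rewrite ?opprK ?oppr0. Qed.

(** These are the coordinates of [w /\ G w]. They are alternating in [a], [b], [c], and for
    increasing indices they are values of [kos g]. *)
Lemma syz_mx_cyclic (w : 'rV[K]_m) : (forall T, (kos g T).@[w 0] = 0) ->
  forall a b c, w 0 a * syz_mx w b c - w 0 b * syz_mx w a c + w 0 c * syz_mx w a b = 0.
Proof.
move=> gw; pose Q a b c := w 0 a * syz_mx w b c - w 0 b * syz_mx w a c + w 0 c * syz_mx w a b.
have Qlt (a b c : 'I_m) : (a < b)%N -> (b < c)%N -> Q a b c = 0.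
  move=> ab bc; have := gw [set a; b; c]; rewrite kos_set3 //.
  rewrite !(mevalD, mevalN, mevalM, mevalXU) !lin_evalE // => <-.
  by rewrite /Q !mxE ab bc (ltn_trans ab bc).
have Q12 a b c : Q a b c = - Q b a c.
  by rewrite /Q (syz_mx_C w b a); ring.
have Q23 a b c : Q a b c = - Q a c b.
  by rewrite /Q (syz_mx_C w c b); ring.
have Waa a : syz_mx w a a = 0 by rewrite mxE ltnn.
have Qaa a c : Q a a c = 0 by rewrite /Q Waa mulr0 subrr addr0.
have Qlt' (a b c : 'I_m) : (a < b)%N -> Q a b c = 0.
  move=> ab; case: (ltngtP b c) => [bc|cb|/val_inj<-]; first exact: Qlt.
    rewrite Q23; case: (ltngtP a c) => [ac|ca|/val_inj<-].
    - by rewrite Qlt ?oppr0.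
    - by rewrite Q12 Qlt ?oppr0.
    - by rewrite Qaa oppr0.
  by rewrite Q23 Q12 Q23 Qaa !oppr0.
move=> a b c; rewrite -/(Q a b c); case: (ltngtP a b) => [ab|ba|/val_inj<-].
- exact: Qlt'.
- by rewrite Q12 Qlt' ?oppr0.
- exact: Qaa.
Qed.

(** From [w /\ G w = 0], contraction with the [a]-th coordinate divided by [w 0 a] expresses [G w]
    through [w] and the contracted vector. *)
Lemma syz_mx_wedge (w : 'rV[K]_m) : w != 0 -> (forall T, (kos g T).@[w 0] = 0) ->
  exists h, syz_mx w = wedge w h.
Proof.
move=> /rV0Pn[a wa] /syz_mx_cyclic Q; exists ((w 0 a)^-1 *: row a (syz_mx w)).
apply/matrixP => b c; apply: (mulfI wa).
have /eqP := Q a b c; rewrite addrAC subr_eq0 => /eqP E.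
have rowE' x : ((w 0 a)^-1 *: row a (syz_mx w)) 0 x = (w 0 a)^-1 * syz_mx w a x.
  by rewrite mxE [row _ _ _ _]mxE.
rewrite wedgeE !rowE'.
have -> : w 0 a * (w 0 b * ((w 0 a)^-1 * syz_mx w a c) -
    (w 0 a)^-1 * syz_mx w a b * w 0 c) = w 0 b * syz_mx w a c - w 0 c * syz_mx w a b.
  by field.
by rewrite -E addrK.
Qed.

(** Evaluation at unit vectors shows that [g [set a; b]] is [h_b 'X_a - h_a 'X_b], the Koszul image
    of the coordinates of [h] placed on singletons. *)
Lemma syz_mx_trivial (h : 'rV[K]_m) : (forall w, syz_mx w = wedge w h) ->
    (forall T : {set 'I_m}, #|T| != 2%N -> g T = 0) ->
  exists y : {set 'I_m} -> K, forall T, g T = kos (fun S => (y S)%:MP) T.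
Proof.
move=> gh g0; pose y (S : {set 'I_m}) := if #|S| == 1%N then \sum_(a in S) h 0 a else 0.
have y1 a : y [set a] = h 0 a by rewrite /y cards1 eqxx big_set1.
exists y => T; have [/cards2P[a [b [nab ->]]]|T2] := boolP (#|T| == 2%N); last first.
  rewrite g0 // /kos big1 // => j jT; rewrite /y ifN ?mpolyC0 ?mulr0 //.
  by apply: contra T2 => /eqP T1; rewrite (cardsD1 j) jT T1.
wlog ab : a b nab / (a < b)%N => [H|].
  have := nab; rewrite -(inj_eq val_inj) neq_ltn => /orP[/H|/H]; first exact.
  by rewrite setUC; apply; rewrite eq_sym.
rewrite kos_set2 // !y1 [LHS]linear_formE //.
have co j : (g [set a; b])@_U_(j) = (j == a)%:R * h 0 b - h 0 a * (j == b)%:R.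
  have /matrixP/(_ a b) := gh (delta_mx 0 j); rewrite wedgeE !mxE ab (eq_sym a) (eq_sym b) /= => <-.
  rewrite /lin_eval (bigD1 j) //= mxE !eqxx mulr1 big1 ?addr0 // => k kj.
  by rewrite mxE (negbTE kj) andbF mulr0.
rewrite (bigD1 a) //= (bigD1 b) 1?eq_sym //= big1 => [|j /andP[ja jb]]; last first.
  by rewrite co (negbTE ja) (negbTE jb) mul0r mulr0 subrr scale0r.
rewrite !co eqxx (negbTE nab) eq_sym (negbTE nab) eqxx !mul0r !mulr0 mul1r mulr1.
rewrite subr0 sub0r addr0 scaleNr; congr (_ - _).
  by rewrite -mul_mpolyC mulrC.
by rewrite -mul_mpolyC mulrC.
Qed.

End KoszulSyzygy.

(** * Points of projective space as vectors *)

Section Points.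
Variables (K : fieldType) (n : nat).
Local Notation E := 'rV[K]_n.+1.
Implicit Types (U V : {vspace E}) (P : pspace K n).

Lemma dim_full : \dim {:E} = n.+1.
Proof. by rewrite dimvf /dim /= mul1n. Qed.

Lemma dim_linsub d (L : linsub K n d) : \dim L = d.+1.
Proof. by case: L => L /= /eqP. Qed.

Lemma enlarge U k : (\dim U <= k)%N -> (k <= n.+1)%N ->
  exists2 V : {vspace E}, (U <= V)%VS & \dim V = k.
Proof.
elim: k => [|k IH] dU kn; first by exists U => //; apply/eqP; rewrite -leqn0.
move: dU; rewrite leq_eqVlt => /predU1P[dU|]; first by exists U; rewrite ?subvv.
rewrite ltnS => /IH/(_ (ltnW kn))[V UV dV].
have /subvPn[x _ xV] : ~~ ({:E} <= V)%VS.
  by apply/negP => /dimvS; rewrite dim_full dV leqNgt kn.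
exists (V + <[x]>)%VS; first by apply: (subv_trans UV); apply: addvSl.
apply/eqP; rewrite eqn_leq; apply/andP; split.
  rewrite (leq_trans (dimv_add_leqif _ _)) // dV dim_vline -[k.+1]addn1 leq_add2l.
  exact: leq_b1.
rewrite -dV (ltn_leqif (dimv_leqif_sup (addvSl _ _))).
by apply: contra xV => /subvP/(_ x); apply; apply/(subvP (addvSr _ _))/memv_line.
Qed.

Definition vec P : E := vpick P.

Lemma vec_mem P : vec P \in (P : {vspace E}).
Proof. exact: memv_pick. Qed.

Lemma vec_neq0 P : vec P != 0.
Proof. by rewrite vpick0 -dimv_eq0 dim_linsub. Qed.

Lemma vec_line P : (P : {vspace E}) = <[vec P]>%VS.
Proof.
apply/eqP; rewrite eq_sym eqEdim -memvE vec_mem dim_linsub dim_vline.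
by rewrite vec_neq0.
Qed.

Lemma sub_vec P U : (P <= U)%VS = (vec P \in U).
Proof. by rewrite [in LHS]vec_line -memvE. Qed.

Definition vecs (X : {fset pspace K n}) : seq E := [seq vec P | P <- enum_fset X].

Lemma vecsP (X : {fset pspace K n}) x :
  reflect (exists2 P, P \in X & x = vec P) (x \in vecs X).
Proof. exact: mapP. Qed.

Lemma span_vecs X : spanning X -> <<vecs X>>%VS = {:E}%VS.
Proof.
move=> spX; apply/eqP; rewrite eqEsubv subvf /=; apply/negPn/negP => nf.
have d : (\dim <<vecs X>> <= n)%N.
  by move: nf; rewrite -(ltn_leqif (dimv_leqif_sup (subvf _))) dim_full ltnS.
have [H XH dH] := enlarge d (leqnSn n).
have [P PX] := spX H dH; rewrite sub_vec => /negP; apply.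
by apply: (subvP XH); apply/memv_span/vecsP; exists P.
Qed.

Lemma free_vecs X k (Y : {fset pspace K n}) :
    (forall Y : {fset pspace K n}, Y `<=` X -> #|` Y| = k.+2 ->
       ~ exists L : linsub K n k, on_linsub Y L)%fset ->
    (k <= n)%N -> (Y `<=` X)%fset -> (#|` Y| = k.+2)%fset ->
  free (vecs Y).
Proof.
move=> gen kn YX cY; apply/negPn/negP => nf; case: (gen Y YX cY).
have dY : (\dim <<vecs Y>> <= k.+1)%N.
  have sz : size (vecs Y) = k.+2 by rewrite size_map.
  by rewrite -ltnS ltn_neqAle -sz dim_span andbT.
have [L YL dL] := enlarge dY kn; exists (@Linsub K n k L (introT eqP dL)).
move=> P PY; rewrite sub_vec; apply: (subvP YL); apply/memv_span/vecsP.
by exists P.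
Qed.

Lemma size_vecs (Y : {fset pspace K n}) : size (vecs Y) = #|` Y|%fset.
Proof. exact: size_map. Qed.

(** Removing a point [P] from [Y] leaves [k.+2] independent vectors, which span [L], so [P] is a
    combination of them. *)
Lemma circuit_vecs X k (Y : {fset pspace K n}) (L : linsub K n k.+1) :
    spanning X -> (k.+2 <= n)%N ->
    (forall Y : {fset pspace K n}, Y `<=` X -> #|` Y| = k.+2 ->
       ~ exists L : linsub K n k, on_linsub Y L)%fset ->
    (Y `<=` X)%fset -> #|` Y|%fset = k.+3 -> on_linsub Y L ->
  circuit (vecs X).
Proof.
move=> spX kn gen YX cY YL; have kn' : (k <= n)%N by rewrite ltnW // ltnW.
have /fset0Pn[P PY] : Y != fset0 by rewrite -cardfs_gt0 cY.
have cD Q : Q \in Y -> #|` Y `\ Q|%fset = k.+2.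
  by move=> QY; have := cardfsD1 Q Y; rewrite QY cY add1n => -[].
have cDD Q : Q \in Y -> Q != P -> #|` (Y `\ Q) `\ P|%fset = k.+1.
  move=> QY QP; have PQ : P \in (Y `\ Q)%fset by rewrite in_fsetD1 eq_sym QP.
  have e1 := cardfsD1 P (Y `\ Q)%fset; rewrite PQ in e1.
  by have /eqP := etrans (esym (cD Q QY)) e1; rewrite add1n eqSS => /eqP.
have DX Q : (Y `\ Q `<=` X)%fset by apply: fsubset_trans YX; apply: fsubD1set.
have fr Q : Q \in Y -> free (vecs (Y `\ Q)%fset).
  by move=> QY; apply: (free_vecs gen kn' (DX Q) (cD Q QY)).
set Z := (Y `\ P)%fset; have fZ : free (vecs Z) := fr P PY.
have sZ : size (vecs Z) = k.+2 by rewrite size_vecs cD.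
have ZL : <<vecs Z>>%VS = L.
  apply/eqP; rewrite eqEdim (eqnP fZ) sZ dim_linsub leqnn andbT.
  apply/span_subvP => _ /vecsP[Q QZ ->]; rewrite -sub_vec; apply: YL.
  by move: QZ; rewrite in_fsetD1 => /andP[].
have PZ : vec P \in <<vecs Z>>%VS by rewrite ZL -sub_vec; apply: YL.
have [q [qE qZ qI]] : exists q : 'I_(size (vecs Z)) -> pspace K n,
    [/\ forall j : 'I_(size (vecs Z)), (vecs Z)`_j = vec (q j), forall j, q j \in Z & injective q].
  have szq (j : 'I_(size (vecs Z))) : (j < size (enum_fset Z))%N.
    by have := ltn_ord j; rewrite [X in (_ < X)%N]size_map.
  exists (fun j => nth P (enum_fset Z) j); split.
  - by move=> j; rewrite (nth_map P).
  - by move=> j; apply: mem_nth.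
  - move=> j l /eqP; rewrite nth_uniq ?fset_uniq // => /eqP; exact: val_inj.
exists (size (vecs Z)), (fun j : 'I_(size (vecs Z)) => (vecs Z)`_j),
  (fun j => coord (in_tuple (vecs Z)) j (vec P)); split.
- by rewrite sZ (span_vecs spX) dim_full ltnS.
- exact: free_indep.
- by move=> j; rewrite qE; apply/vecsP; exists (q j) => //; apply: (fsubsetP (DX P)).
(* A zero coefficient at [q j] would put [P] in the span of the other [k.+1] points, against the
   independence of [Y] without [q j]. *)
- move=> j; apply/eqP => cj0.
  have qY : q j \in Y by have := qZ j; rewrite in_fsetD1 => /andP[].
  have qP : q j != P by have := qZ j; rewrite in_fsetD1 => /andP[].
  pose Z' := (Y `\ q j)%fset; have PZ' : P \in Z' by rewrite in_fsetD1 eq_sym qP.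
  have c' : #|` Z' `\ P|%fset = k.+1 := cDD _ qY qP.
  have : (<<vecs Z'>> <= <<vecs (Z' `\ P)%fset>>)%VS.
    apply/span_subvP => _ /vecsP[Q QZ' ->].
    have [->|QP] := eqVneq Q P; last first.
      by apply/memv_span/vecsP; exists Q; first by rewrite in_fsetD1 QP QZ'.
    rewrite (@coord_span _ _ _ (in_tuple (vecs Z)) _ PZ); apply: memv_suml => l _.
    have [->|lj] := eqVneq l j; first by rewrite cj0 scale0r mem0v.
    rewrite memvZ //= qE; apply/memv_span/vecsP; exists (q l); last by [].
    have [nP lY] : q l != P /\ q l \in Y by have := qZ l; rewrite in_fsetD1 => /andP[].
    rewrite in_fsetD1 nP /Z'.
    rewrite in_fsetD1.
    rewrite lY.
    rewrite (inj_eq qI) lj.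
    by [].
  have d1 : \dim <<vecs Z'>>%VS = k.+2.
    exact: etrans (eqnP (fr _ qY)) (etrans (size_vecs _) (cD _ qY)).
  have d2 : size (vecs (Z' `\ P)%fset) = k.+1 := etrans (size_vecs _) c'.
  move/dimvS => /(leq_trans (eq_leq (esym d1))) le.
  by have := leq_trans le (leq_trans (dim_span _) (eq_leq d2)); rewrite ltnn.
apply/vecsP; exists P; first exact: (fsubsetP YX).
by rewrite -(@coord_span _ _ _ (in_tuple (vecs Z)) _ PZ).
Qed.

End Points.

(** * From Betti numbers to syzygies, and from separation to linear subspaces *)

Lemma linear_betti_syz (K : fieldType) (n : nat) (X : {fset pspace K n}) :
    (1 < n)%N -> spanning X -> linear_betti X (n - 1) <> 0%N ->
  exists2 G : 'Hom('rV[K]_n.+1, 'M[K]_n.+1), syz (vecs X) G & ~ trivial (vecs X) G.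
Proof.
case: n X => [|[|p]] // X _ spX; rewrite subn1 /= => ne0.
(* [tor_dim] defaults to 0 on an empty set of values, so a nonzero value is attained by some
   resolution. *)
have [F hF] : exists F : graded_free_resolution (vanishing_ideal X),
    homology_dim F p.+1 p.+2 <> 0%N.
  apply: contrapT => none; apply: ne0; rewrite /linear_betti /tor_dim.
  case: classical_sets.xgetP => // t _ [F ->].
  by apply: contrapT => hF; apply: none; exists F.
have [|g [g1 g2 gI gn]] := koszul_class (vanishing_ideal_ideal X) hF; first by lia.
(* With [n = p.+2] there are [p.+3] variables, so the class lives on pairs of indices. *)
have c2 : (p.+3 - p.+1 = 2)%N by lia.
rewrite {}c2 in g2.
exists (linfun (syz_mx g)).
  move=> _ /vecsP[P PX ->]; rewrite lfunE /=.
  have [T|h ->] := @syz_mx_wedge _ _ g g1 (vec P) (vec_neq0 P).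
    have := gI T 2%N P (vec P) PX (vec_mem P); rewrite pihomog_dE //.
    exact: kos_homog.
  by exists h; rewrite // span_vecs // memvf.
case=> h _ Gh; apply: gn; apply: (@syz_mx_trivial _ _ g g1 h) => // w.
have : w \in <<vecs X>>%VS by rewrite span_vecs // memvf.
apply: (span_ind (P := fun w => syz_mx g w = wedge w h)).
- by rewrite linear0 wedge0l.
- by move=> a u v Hu Hv; rewrite linearP /= Hu Hv wedgeDl wedgeZl.
by move=> x /Gh; rewrite lfunE.
Qed.

Lemma sep_linsubs (K : fieldType) (n : nat) (X : {fset pspace K n}) :
    (1 < n)%N -> spanning X -> sep (vecs X) ->
  exists k r : nat, [/\ (0 < k)%N, (0 < r)%N, (k + r)%N = n
    & exists (L : linsub K n k) (M : linsub K n r),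
        forall P : pspace K n, P \in X -> (P <= L)%VS || (P <= M)%VS].
Proof.
move=> n1 spX [L [M [cX]]]; rewrite span_vecs // dim_full => dLM dL dM.
(* The maximum keeps [k] positive when [\dim L <= 1]; then [M], being proper, still fits in vector
   dimension [n - k + 1 = n]. *)
pose k := maxn 1 (\dim L).-1.
have [||L' LL' dL'] := @enlarge K n L k.+1; try by rewrite /k; dlia.
have [||M' MM' dM'] := @enlarge K n M (n - k).+1; try by rewrite /k; dlia.
exists k, (n - k)%N; split; try by rewrite /k; dlia.
exists (Linsub (introT eqP dL')), (Linsub (introT eqP dM')) => P PX.
rewrite !sub_vec; have [|xL|xM] := cX (vec P); first by apply/vecsP; exists P.
  by rewrite (subvP LL' _ xL).
by rewrite (subvP MM' _ xM) orbT.
Qed.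

Local Open Scope fset_scope.

Theorem theorem1p3 (K : closedFieldType) (n : nat) (X : {fset pspace K n})
    (spanX : spanning X) (i : nat) (le_i_n2 : (i + 2 <= n)%N)
    (dependent : exists Y : {fset pspace K n},
       [/\ Y `<=` X, #|` Y| = (n - i + 1)%N
         & exists L : linsub K n (n - i - 1), on_linsub Y L])
    (general : forall Y : {fset pspace K n},
       Y `<=` X -> #|` Y| = (n - i)%N ->
       ~ exists L : linsub K n (n - i - 2), on_linsub Y L)
    (a_neq0 : linear_betti X (n - 1) <> 0%N) :
  exists k r : nat, [/\ (0 < k)%N, (0 < r)%N, (k + r)%N = n
    & exists (L : linsub K n k) (M : linsub K n r),
        forall P : pspace K n, P \in X -> (P <= L)%VS || (P <= M)%VS].
Proof.
have n1 : (1 < n)%N by apply: leq_trans le_i_n2; rewrite leq_addl.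
apply: sep_linsubs => //; have [G sG ntG] := linear_betti_syz n1 spanX a_neq0.
(* With this [k], hypothesis (1) gives [k.+3] points on a subspace of projective dimension [k.+1],
   and (2) makes any [k.+2] points independent. *)
apply: (sep_ind (ltnSn _) sG ntG); pose k := (n - i - 2)%N.
have [e1 e2] : (n - i - 1 = k.+1 /\ n - i = k.+2)%N by rewrite /k; lia.
have e3 : (n - i + 1 = k.+3)%N by rewrite e2 addn1.
have [Y [YX cY [L YL]]] := dependent; rewrite e3 in cY.
rewrite e1 in L YL; apply: (@circuit_vecs K n X k Y L) => //; first by rewrite -e2 leq_subr.
by move=> Z ZX cZ; apply: general => //; rewrite e2.
Qed.
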